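(* Let $d\ge 1$ and $a>0$. There is a constant $c>0$ depending only on $d$ and $a$ such that for every real-valued $h\in(L^1\cap L^2)(\mathbb{R}^d)$ and every $R>0$, $$\mathrm{Var}\big(N_{s}(h,R)\big)\ge c\left(R^{d-2}\int_{|\lambda|\le R}|\widehat h(\lambda)|^2|\lambda|^2\,dm_d(\lambda)+R^d\int_{|\lambda|\ge R}|\widehat h(\lambda)|^2\,dm_d(\lambda)\right).$$
   Context: $m_d$ is Lebesgue measure on $\mathbb{R}^d$, and $|\cdot|$, $\langle\cdot,\cdot\rangle$ are the Euclidean norm and inner product. For a fixed $a>0$, $\{\xi_n\}_{n\in\mathbb{Z}^d}$ are independent identically distributed random vectors in $\mathbb{R}^d$ with density $\phi_a(x)=(a\pi)^{-d/2}e^{-|x|^2/a}$ with respect to $m_d$, and $\zeta$ is a random vector uniformly distributed on $[0,1]^d$ and independent of all the $\xi_n$. The stationarized point process is $W_{s}=\{n+\xi_n+\zeta: n\in\mathbb{Z}^d\}$, and its linear statistic is $N_{s}(h,R)=\sum_{w\in W_s}h(w/R)=\sum_{n\in\mathbb{Z}^d}h\big((n+\xi_n+\zeta)/R\big)$. The variance is $\mathrm{Var}(X)=\mathbb{E}[(X-\mathbb{E}X)^2]$. The Fourier transform is $\widehat f(\lambda)=\int_{\mathbb{R}^d}f(x)e^{-2\pi i\langle x,\lambda\rangle}\,dm_d(x)$. *)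

(* Defs.v *)
From HB Require Import structures.
From mathcomp Require Import all_boot all_order all_algebra finmap.
From mathcomp Require Import complex.
From mathcomp Require Import all_classical all_reals all_analysis.

Set Implicit Arguments.
Unset Strict Implicit.
Unset Printing Implicit Defensive.

Import Order.TTheory GRing.Theory Num.Theory.
Import numFieldNormedType.Exports.

Local Open Scope classical_set_scope.
Local Open Scope ring_scope.
Local Open Scope complex_scope.

(* R^d is d.-tuple R with the product (= Borel) sigma-algebra, and Z^d is
   d.-tuple int; tuples carry no vector-space structure in the library. *)

Definition vadd (R : realType) (d : nat) (x y : d.-tuple R) : d.-tuple R :=
  [tuple tnth x i + tnth y i | i < d].

Definition vscale (R : realType) (d : nat) (c : R) (x : d.-tuple R) :
    d.-tuple R :=
  [tuple c * tnth x i | i < d].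

Definition vint (R : realType) (d : nat) (n : d.-tuple int) : d.-tuple R :=
  [tuple (tnth n i)%:~R | i < d].

Definition inner (R : realType) (d : nat) (x y : d.-tuple R) : R :=
  \sum_(i < d) tnth x i * tnth y i.

Definition enorm (R : realType) (d : nat) (x : d.-tuple R) : R :=
  Num.sqrt (inner x x).

Definition unit_cube (R : realType) (d : nat) : set (d.-tuple R) :=
  [set x | forall i, 0 <= tnth x i <= 1].

Definition tcons (R : realType) (d : nat) (x : R * d.-tuple R) :
    d.+1.-tuple R :=
  [tuple of x.1 :: x.2].

Lemma measurable_tcons (R : realType) (d : nat) :
  measurable_fun [set: R * d.-tuple R] (@tcons R d).
Proof. exact: measurable_cons. Qed.

(* The product measure on a power of R, transported along
   R * R^d ~ R^(d+1) at each step. *)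
Fixpoint lebesgue_vec (R : realType) (d : nat) : set (d.-tuple R) -> \bar R :=
  match d return set (d.-tuple R) -> \bar R with
  | 0%N => \d_([tuple] : 0.-tuple R)
  | d'.+1 =>
      pushforward (@lebesgue_measure R \x @lebesgue_vec R d')%E (@tcons R d')
  end.

Lemma product_sigma_finite (d1 d2 : measure_display)
    (T1 : measurableType d1) (T2 : measurableType d2) (R : realType)
    (m1 : {sigma_finite_measure set T1 -> \bar R})
    (m2 : {sigma_finite_measure set T2 -> \bar R}) :
  sigma_finite setT (m1 \x m2)%E.
Proof.
have /sigma_finiteP[F [TF ndF Foo]] := sigma_finiteT m1.
have /sigma_finiteP[G [TG ndG Goo]] := sigma_finiteT m2.
exists (fun n => F n `*` G n) => [|k].
  rewrite -setXTT TF TG; apply/seteqP; split=> [[x y]|[x y]].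
    move=> [/= [n _ Fnx] [k _ Gky]]; exists (maxn n k) => //; split.
      by move: x Fnx; exact/subsetPset/ndF/leq_maxl.
    by move: y Gky; exact/subsetPset/ndG/leq_maxr.
  by move=> [n _ [/= Fnx Gny]]; split; exists n.
have [mF Fk] := Foo k; have [mG Gk] := Goo k.
split; first exact: measurableX.
by rewrite product_measure1E// lte_mul_pinfty// ge0_fin_numE.
Qed.

Lemma pushforward_sigma_finite (d1 d2 : measure_display)
    (T1 : measurableType d1) (T2 : measurableType d2) (R : realType)
    (m : {measure set T1 -> \bar R}) (f : T1 -> T2) (g : T2 -> T1) :
  measurable_fun setT g -> cancel f g -> sigma_finite setT m ->
  sigma_finite setT (pushforward m f).
Proof.
move=> mg fK [F UF mF]; exists (fun k => g @^-1` F k) => [|k].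
  by rewrite -preimage_bigcup -UF preimage_setT.
have [mFk Fk] := mF k; split.
  by rewrite -[X in measurable X]setTI; exact: mg.
by rewrite /pushforward -comp_preimage (_ : g \o f = id)//; exact/funext.
Qed.

Lemma lebesgue_vec_sigma_finite_measure (R : realType) (d : nat) :
  exists m : {sigma_finite_measure set (d.-tuple R) -> \bar R},
    @lebesgue_vec R d = m.
Proof.
elim: d => [|d [m mE]]; first by exists (\d_([tuple] : 0.-tuple R)).
pose uncons (x : d.+1.-tuple R) : R * d.-tuple R :=
  (thead x, [tuple of behead x]).
have uK : cancel (@tcons R d) uncons.
  by move=> [r x]; rewrite /uncons /thead tnth0; congr pair; exact/val_inj.
have mu : measurable_fun setT uncons.
  apply/measurable_fun_pairP; split; [exact: measurable_tnth|].
  exact: measurable_behead.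
have mt := @measurable_tcons R d.
pose p := (@lebesgue_measure R \x m)%E.
have /= ps : sigma_finite setT p by exact: product_sigma_finite.
rewrite /= mE -/p.
set q := pushforward _ _.
have q0 : q set0 = 0%E by exact: (@measure0 _ _ _ p).
have q_ge0 A : (0 <= q A)%E by exact: (@measure_ge0 _ _ _ p).
have q_sigma : semi_sigma_additive q.
  by exact: (@measure_semi_sigma_additive _ _ _ (pushforward p (@tcons R d))).
have q_sigma_finite : sigma_finite setT q.
  exact: (@pushforward_sigma_finite _ _ _ _ _ p _ uncons mu uK ps).
clearbody q.
pose q1 := isMeasure.Build _ _ _ q q0 q_ge0 q_sigma.
pose qm : {measure set (d.+1.-tuple R) -> \bar R} := HB.pack q q1.
pose q2 := Measure_isSigmaFinite.Build _ _ _ qm q_sigma_finite.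
pose qs : {sigma_finite_measure set (d.+1.-tuple R) -> \bar R} :=
  HB.pack q q1 q2.
by exists qs.
Qed.

Lemma lebesgue_vec0 (R : realType) (d : nat) : @lebesgue_vec R d set0 = 0%E.
Proof. by have [m ->] := lebesgue_vec_sigma_finite_measure R d. Qed.

Lemma lebesgue_vec_ge0 (R : realType) (d : nat) A :
  (0 <= @lebesgue_vec R d A)%E.
Proof. by have [m ->] := lebesgue_vec_sigma_finite_measure R d. Qed.

Lemma lebesgue_vec_sigma_additive (R : realType) (d : nat) :
  semi_sigma_additive (@lebesgue_vec R d).
Proof.
have [m ->] := lebesgue_vec_sigma_finite_measure R d.
exact: measure_semi_sigma_additive.
Qed.

Lemma sigma_finite_lebesgue_vec (R : realType) (d : nat) :
  sigma_finite setT (@lebesgue_vec R d).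
Proof.
have [m ->] := lebesgue_vec_sigma_finite_measure R d.
exact: sigma_finiteT.
Qed.

HB.instance Definition _ (R : realType) (d : nat) :=
  isMeasure.Build _ _ _ (@lebesgue_vec R d) (@lebesgue_vec0 R d)
    (@lebesgue_vec_ge0 R d) (@lebesgue_vec_sigma_additive R d).

HB.instance Definition _ (R : realType) (d : nat) :=
  Measure_isSigmaFinite.Build _ _ _ (@lebesgue_vec R d)
    (@sigma_finite_lebesgue_vec R d).

Lemma lebesgue_vec_box (R : realType) (d : nat) (A : 'I_d -> set R) :
  (forall i, measurable (A i)) ->
  @lebesgue_vec R d [set x | forall i, A i (tnth x i)] =
  (\prod_(i < d) @lebesgue_measure R (A i))%E.
Proof.
elim: d A => [|d IH] A mA.
  rewrite big_ord0 /= (_ : [set x | _] = setT) ?diracT//.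
  by apply/seteqP; split => // x _ [].
rewrite big_ord_recl -IH => [|i]; last exact: mA.
rewrite /= /pushforward; set B := [set x | forall i, A (lift ord0 i) _].
have mB : measurable B.
  have -> : B = \bigcap_(i in [set: 'I_d])
      ((fun x : d.-tuple R => tnth x i) @^-1` A (lift ord0 i)).
    by apply/seteqP; split=> [x Bx i _|x Bx i]; [exact: Bx|exact: Bx i I].
  apply: fin_bigcap_measurable => [|i _]; first exact: finite_finset.
  by rewrite -[X in measurable X]setTI; exact: measurable_tnth.
rewrite -(product_measure1E (@lebesgue_measure R) (@lebesgue_vec R d))//; last exact: mA.
congr product_measure1; apply/seteqP; split=> [[r x] /= Ax|[r x] /= [Ar Bx] i].
  split; first by have := Ax ord0.
  by move=> i /=; have := Ax (lift ord0 i); rewrite tnthS.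
by case: (unliftP ord0 i) => [j ->|-> //]; rewrite tnthS; exact: Bx.
Qed.

(* There is no complex-valued integral in the library. *)
Definition Cintegral (d : measure_display) (T : measurableType d)
    (R : realType) (mu : {measure set T -> \bar R}) (f : T -> R[i]) : R[i] :=
  (\int[mu]_x complex.Re (f x)) +i* (\int[mu]_x complex.Im (f x)).

Definition expi (R : realType) (t : R) : R[i] := cos t +i* sin t.

Definition fourier (R : realType) (d : nat) (f : d.-tuple R -> R)
    (l : d.-tuple R) : R[i] :=
  Cintegral (@lebesgue_vec R d)
    (fun x => (f x)%:C * expi (- (2 * pi * inner x l))).

Definition gauss_density (R : realType) (d : nat) (a : R) (x : d.-tuple R) :
    R :=
  (a * pi) `^ (- (d%:R / 2)) * expR (- (enorm x ^+ 2 / a)).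

Definition mutually_independent (disp disp' : measure_display)
    (Omega : measurableType disp) (T : measurableType disp') (R : realType)
    (P : probability Omega R) (I : choiceType) (X : I -> {RV P >-> T}) : Prop :=
  forall (J : {fset I}) (A : I -> set T), (forall i, measurable (A i)) ->
    P (\bigcap_(i in [set` J]) (X i @^-1` A i)) =
    (\prod_(i <- J) P (X i @^-1` A i))%E.

Definition generated_by (disp disp' : measure_display)
    (Omega : measurableType disp) (T : measurableType disp') (R : realType)
    (P : probability Omega R) (I : Type) (X : I -> {RV P >-> T}) :
    set (set Omega) :=
  <<s \bigcup_i preimage_set_system setT (X i) measurable >>.

Definition independent_of_family (disp disp' : measure_display)
    (Omega : measurableType disp) (T : measurableType disp') (R : realType)
    (P : probability Omega R) (I : Type) (Y : {RV P >-> T})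
    (X : I -> {RV P >-> T}) : Prop :=
  forall (A : set T) (B : set Omega), measurable A -> generated_by X B ->
    P ((Y @^-1` A) `&` B) = (P (Y @^-1` A) * P B)%E.

Definition has_density (disp : measure_display) (Omega : measurableType disp)
    (R : realType) (P : probability Omega R) (d : nat)
    (X : {RV P >-> d.-tuple R}) (f : d.-tuple R -> R) : Prop :=
  forall A, measurable A ->
    distribution P X A = (\int[@lebesgue_vec R d]_(x in A) (f x)%:E)%E.

Definition uniform_on_cube (disp : measure_display)
    (Omega : measurableType disp) (R : realType) (P : probability Omega R)
    (d : nat) (X : {RV P >-> d.-tuple R}) : Prop :=
  forall A, measurable A ->
    distribution P X A = @lebesgue_vec R d (A `&` @unit_cube R d).

Definition stationary_model (disp : measure_display)
    (Omega : measurableType disp) (R : realType) (P : probability Omega R)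
    (d : nat) (a : R) (xi : d.-tuple int -> {RV P >-> d.-tuple R})
    (zeta : {RV P >-> d.-tuple R}) : Prop :=
  [/\ mutually_independent xi,
      forall n, has_density (xi n) (@gauss_density R d a),
      uniform_on_cube zeta &
      independent_of_family zeta xi].

(* The value is the usual sum when f is absolutely summable, and is
   meaningless otherwise. *)
Definition unordered_sum (R : realType) (I : choiceType) (f : I -> R) : R :=
  fine (\esum_(i in [set: I]) (f^\+ i)%:E) -
  fine (\esum_(i in [set: I]) (f^\- i)%:E).

Definition Ws (R : realType) (Omega : Type) (d : nat)
    (xi : d.-tuple int -> Omega -> d.-tuple R) (zeta : Omega -> d.-tuple R)
    (n : d.-tuple int) (w : Omega) : d.-tuple R :=
  vadd (vadd (@vint R d n) (xi n w)) (zeta w).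

(* For h in L^1 the series converges absolutely almost surely. *)
Definition Ns (R : realType) (Omega : Type) (d : nat)
    (xi : d.-tuple int -> Omega -> d.-tuple R) (zeta : Omega -> d.-tuple R)
    (h : d.-tuple R -> R) (r : R) (w : Omega) : R :=
  unordered_sum (fun n => h (vscale r^-1 (Ws xi zeta n w))).

(* Main.v *)
(** Write [X = N_s(h, R)] as the sum over [n] of [X_n = h((n + xi_n + zeta) / R)].
    Given [zeta] the [X_n] are independent, so subtracting from [X] its conditional
    fluctuation, i.e. integrating [(X - E X - Y) ^ 2 >= 0] for finite partial sums
    [Y] of the [X_n - E(X_n | zeta)], gives [Var X >= \sum_n E Var(X_n | zeta)].
    Each conditional variance is half the mean squared difference of [h] at two
    points displaced by independent Gaussians [u], [v]; as the cubes [n + [0,1)^d]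
    tile the space, the sum over [n] becomes half the mean of the squared L^2
    norm of [h((. + u) / R) - h((. + v) / R)].

    Bessel's inequality bounds this norm below on the Fourier side, where averaging
    [|exp(i s.u) - exp(i s.v)| ^ 2] over [u], [v] leaves
    [R^d * \int |h^|^2 (1 - exp(- 2 pi^2 a |l|^2 / R^2))]. Finally
    [1 - exp(- k q) >= k / (1 + k) * min(1, q)].

    Bessel's inequality itself follows from the Fourier transform of the Gaussian:
    the integral of [|f^|^2] against a Gaussian weight is a double integral of
    [f(x) f(y)] against a Gaussian kernel in [x - y], bounded by
    [(f(x)^2 + f(y)^2) / 2], and the weight is then widened to [1]. *)

From HB Require Import structures.
Require Import Defs.
From mathcomp Require Import all_boot all_order all_algebra finmap.
From mathcomp Require Import complex.
From mathcomp Require Import all_classical all_reals all_analysis.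
From mathcomp Require Import measurable_realfun ring lra.

Import Order.TTheory GRing.Theory Num.Theory.
Import numFieldNormedType.Exports.

Local Open Scope classical_set_scope.
Local Open Scope ring_scope.

Set Implicit Arguments.
Unset Strict Implicit.
Unset Printing Implicit Defensive.

(** The variance is an extended real and no L^2 bound on [X] is proved beforehand, so an orthogonal
    projection of [X] is not at hand: the estimate uses only that each product of [X] with a
    fluctuation is integrable. Even this takes care, since [X] is an infinite series; the
    fluctuations are therefore cut off to the values of [zeta] at which the conditional expectation
    of the sum of the absolute terms is at most [K]. The cut-off depends on [zeta] alone, so it
    preserves conditional centring, and monotone convergence in [K] removes it at the end.

    Conditional means are awkward on the Fourier side, whereas the gap between two independent
    copies is a difference of two explicit translates of [h], whose spectrum is [|h^|^2] times the
    squared distance of two points of the unit circle.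

    The constant is [k / (1 + k) / 2] with [k = 2 pi^2 a]; the last factor 1/2 pays for bounding the
    integrals over [|l| <= R] and over [|l| >= R] separately by one and the same full integral. *)

Section real_integrable.
Context d (T : measurableType d) (R : realType) (mu : {measure set T -> \bar R}).
Implicit Types (f g : T -> R) (k : R).

Lemma Rintegrable_measurable f :
  mu.-integrable setT (EFin \o f) -> measurable_fun setT f.
Proof. by move=> /measurable_int /measurable_EFinP. Qed.

Lemma RintegrableD f g : mu.-integrable setT (EFin \o f) ->
  mu.-integrable setT (EFin \o g) ->
  mu.-integrable setT (EFin \o (fun x => f x + g x)).
Proof.
move=> intf intg.
have := @integrableD _ _ _ mu setT measurableT (EFin \o f) (EFin \o g) intf intg.
by apply: eq_integrable => // x _; rewrite /= EFinD.
Qed.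

Lemma RintegrableZl k f : mu.-integrable setT (EFin \o f) ->
  mu.-integrable setT (EFin \o (fun x => k * f x)).
Proof.
move=> intf; have := @integrableZl _ _ _ mu setT measurableT k _ intf.
by apply: eq_integrable => // x _; rewrite /= EFinM.
Qed.

Lemma RintegrableB f g : mu.-integrable setT (EFin \o f) ->
  mu.-integrable setT (EFin \o g) ->
  mu.-integrable setT (EFin \o (fun x => f x - g x)).
Proof.
move=> intf intg.
have := @integrableB _ _ _ mu setT measurableT (EFin \o f) (EFin \o g) intf intg.
by apply: eq_integrable => // x _; rewrite /= EFinB.
Qed.

Lemma le_Rintegrable f g : measurable_fun setT f -> (forall x, `|f x| <= g x) ->
  mu.-integrable setT (EFin \o g) -> mu.-integrable setT (EFin \o f).
Proof.
move=> mf fg; apply: le_integrable => //; first exact/measurable_EFinP.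
by move=> x _; rewrite /= lee_fin (le_trans (fg x))// ler_norm.
Qed.

Lemma Rintegrable_norm f : mu.-integrable setT (EFin \o f) ->
  mu.-integrable setT (EFin \o (fun x => `|f x|)).
Proof. by move=> /integrable_abse; apply: eq_integrable. Qed.

Lemma RintegrableM_le1 f g : measurable_fun setT g -> (forall x, `|g x| <= 1) ->
  mu.-integrable setT (EFin \o f) ->
  mu.-integrable setT (EFin \o (fun x => f x * g x)).
Proof.
move=> mg g1 intf; apply: (@le_Rintegrable _ (fun x => `|f x|)).
- by apply: measurable_funM => //; exact: Rintegrable_measurable.
- by move=> x; rewrite normrM ler_piMr.
- exact: Rintegrable_norm.
Qed.

Lemma EFin_Rintegral f : mu.-integrable setT (EFin \o f) ->
  ((\int[mu]_x f x)%:E = \int[mu]_x (f x)%:E)%E.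
Proof. by move=> intf; rewrite /Rintegral fineK// integrable_fin_num. Qed.

End real_integrable.

(** * Partial integrals and product measures *)

Section measurable_partial_integral.
Context d1 d2 (T1 : measurableType d1) (T2 : measurableType d2) (R : realType).
Implicit Type G : T1 * T2 -> \bar R.

Lemma measurable_integral_snd (m2 : {sigma_finite_measure set T2 -> \bar R}) G :
  measurable_fun setT G -> (forall z, (0 <= G z)%E) ->
  measurable_fun setT (fun x => \int[m2]_y G (x, y))%E.
Proof. exact: measurable_fun_fubini_tonelli_F. Qed.

Lemma measurable_integral_fst (m1 : {sigma_finite_measure set T1 -> \bar R}) G :
  measurable_fun setT G -> (forall z, (0 <= G z)%E) ->
  measurable_fun setT (fun y => \int[m1]_x G (x, y))%E.
Proof. exact: measurable_fun_fubini_tonelli_G. Qed.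

End measurable_partial_integral.

(** Splitting into positive and negative parts gives measurability even across the points [x] where
    the inner integral is not finite: there [fine] supplies a default value. *)
Lemma measurable_Rintegral_snd d1 d2 (T1 : measurableType d1) (T2 : measurableType d2)
    (R : realType) (m2 : {sigma_finite_measure set T2 -> \bar R}) (G : T1 * T2 -> R) :
  measurable_fun setT G ->
  measurable_fun setT (fun x => \int[m2]_y G (x, y)).
Proof.
move=> mG; apply: (@measurableT_comp _ _ _ _ _ _ (@fine R)); first exact: fine_measurable.
rewrite (_ : (fun x => _) = (fun x => \int[m2]_y ((EFin \o G)^\+%E (x, y)) -
    \int[m2]_y ((EFin \o G)^\-%E (x, y)))%E); last first.
  apply/funext => x; rewrite [LHS]integralE; congr (_ - _)%E; apply: eq_integral => y _.
    by rewrite !funeposE.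
  by rewrite !funenegE.
apply: emeasurable_funB; apply: measurable_integral_snd => //.
- by apply: measurable_funepos; apply/measurable_EFinP.
- by apply: measurable_funeneg; apply/measurable_EFinP.
Qed.

Section product_integrable.
Context d1 d2 (T1 : measurableType d1) (T2 : measurableType d2) (R : realType).
Variables (m1 : {sigma_finite_measure set T1 -> \bar R})
  (m2 : {sigma_finite_measure set T2 -> \bar R}).

Lemma ge0_integral_prodM (f : T1 -> R) (g : T2 -> R) :
  measurable_fun setT f -> measurable_fun setT g ->
  (forall x, 0 <= f x) -> (forall y, 0 <= g y) ->
  (\int[m1]_x \int[m2]_y (f x * g y)%:E =
   \int[m1]_x (f x)%:E * \int[m2]_y (g y)%:E)%E.
Proof.
move=> mf mg f0 g0.
under eq_integral => x _.
  under eq_integral do rewrite EFinM.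
  rewrite ge0_integralZl_EFin//; last 2 first.
    by move=> y _; rewrite lee_fin.
    exact/measurable_EFinP.
  rewrite muleC.
  over.
rewrite ge0_integralZl//.
- by rewrite muleC.
- exact/measurable_EFinP.
- by move=> x _; rewrite lee_fin.
- by apply: integral_ge0 => y _; rewrite lee_fin.
Qed.

Lemma integrable_prodM (f : T1 -> R) (g : T2 -> R) :
  m1.-integrable setT (EFin \o f) -> m2.-integrable setT (EFin \o g) ->
  (m1 \x m2)%E.-integrable setT (EFin \o (fun z => f z.1 * g z.2)).
Proof.
move=> intf intg.
have mf := Rintegrable_measurable intf; have mg := Rintegrable_measurable intg.
apply/integrable12ltyP.
  apply/measurable_EFinP; apply: measurable_funM; exact: measurableT_comp.
under eq_integral do under eq_integral do rewrite /= normrM.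
rewrite (ge0_integral_prodM (f := fun x => `|f x|) (g := fun x => `|g x|))//.
- apply: lte_mul_pinfty.
  + exact: integral_ge0.
  + by have /integrableP[_] := intf; rewrite ge0_fin_numE// integral_ge0.
  + by have /integrableP[_] := intg.
- exact: measurableT_comp.
- exact: measurableT_comp.
Qed.

End product_integrable.

(* The product of two sigma-finite measures is not canonically recognized as
   sigma-finite, which Fubini over three factors requires. *)
Definition prod_measure d1 d2 (T1 : measurableType d1) (T2 : measurableType d2)
    (R : realType) (m1 : {sigma_finite_measure set T1 -> \bar R})
    (m2 : {sigma_finite_measure set T2 -> \bar R}) :
    {sigma_finite_measure set (T1 * T2)%type -> \bar R} :=
  let q := Measure_isSigmaFinite.Build _ _ _ (m1 \x m2)%E
    (product_sigma_finite m1 m2) in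
  HB.pack (m1 \x m2)%E q.

(** * Fourier transform of the Gaussian *)

Section gauss1.
Context {R : realType}.
Local Notation leb := (@lebesgue_measure R).

Definition gauss_kernel (b x : R) : R := expR (- (x ^+ 2 / b)).

Lemma measurable_gauss_kernel b : measurable_fun setT (gauss_kernel b).
Proof.
apply: measurableT_comp => //; apply: measurableT_comp => //.
by apply: measurable_funM => //; exact: measurable_funX.
Qed.

Lemma gauss_kernel_ge0 b x : 0 <= gauss_kernel b x.
Proof. exact: expR_ge0. Qed.

Lemma integral_gauss_kernel b : 0 < b ->
  (\int[leb]_x (gauss_kernel b x)%:E = (Num.sqrt (b * pi))%:E)%E.
Proof.
(* The kernel is a centred normal density of variance [b / 2], up to its peak value. *)
move=> b0; pose s := Num.sqrt (b / 2).
have s2 : s ^+ 2 *+ 2 = b.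
  by rewrite sqr_sqrtr ?divr_ge0 ?ltW// -mulr_natr divfK.
have s0 : s != 0 by rewrite gt_eqF// sqrtr_gt0 divr_gt0.
have p0 : normal_peak s != 0 by rewrite gt_eqF// normal_peak_gt0.
have -> : Num.sqrt (b * pi) = (normal_peak s)^-1.
  by rewrite /normal_peak invrK -mulrnAl s2.
have E x : gauss_kernel b x = (normal_peak s)^-1 * normal_pdf 0 s x.
  by rewrite normal_pdfE// mulKf// /normal_fun s2 subr0 mulNr.
under eq_integral do rewrite E EFinM.
rewrite integralZl//; last exact: integrable_normal_pdf.
by rewrite integral_normal_pdf mule1.
Qed.

Lemma integrable_gauss_kernel b : 0 < b ->
  leb.-integrable setT (EFin \o gauss_kernel b).
Proof.
move=> b0; apply/integrableP; split.
  by apply/measurable_EFinP; exact: measurable_gauss_kernel.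
under eq_integral do rewrite /= ger0_norm ?expR_ge0//.
by rewrite integral_gauss_kernel// ltry.
Qed.

(** Half of the exponent is spent on absorbing the factor [|x|], through [expR y >= 1 + y] at
    [y = x ^ 2 / (2 b)]. The bound makes [|x| * gauss_kernel b x] integrable, which is the
    domination needed to differentiate under the integral. *)
Lemma normr_gauss_kernel_le b x : 0 < b ->
  `|x| * gauss_kernel b x <= (1 + 2 * b) * gauss_kernel (2 * b) x.
Proof.
move=> b0; rewrite /gauss_kernel.
have -> : - (x ^+ 2 / b) = - (x ^+ 2 / (2 * b)) - (x ^+ 2 / (2 * b)).
  by field; rewrite gt_eqF.
rewrite expRD mulrA ler_pM2r ?expR_gt0// expRN ler_pdivrMr ?expR_gt0//.
apply: (@le_trans _ _ ((1 + 2 * b) * (1 + x ^+ 2 / (2 * b)))); last first.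
  by rewrite ler_pM2l ?expR_ge1Dx// ltr_wpDl// mulr_gt0.
have -> : (1 + 2 * b) * (1 + x ^+ 2 / (2 * b)) =
    1 + 2 * b + x ^+ 2 / (2 * b) + x ^+ 2 by field; rewrite gt_eqF.
rewrite -(real_normK (num_real x)).
have : 0 <= `|x| ^+ 2 / (2 * b) by rewrite divr_ge0 ?sqr_ge0// mulr_ge0// ltW.
have := normr_ge0 x; nra.
Qed.

Lemma integrable_normr_gauss_kernel b : 0 < b ->
  leb.-integrable setT (EFin \o (fun x => `|x| * gauss_kernel b x)).
Proof.
move=> b0.
apply: (@le_integrable _ _ _ leb _ _ _ (EFin \o (fun x => (1 + 2 * b) * gauss_kernel (2 * b) x))) => //.
- apply/measurable_EFinP; apply: measurable_funM => //.
  exact: measurable_gauss_kernel.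
- move=> x _; rewrite lee_fin ger0_norm ?mulr_ge0 ?expR_ge0//.
  exact/(le_trans (normr_gauss_kernel_le x b0))/ler_norm.
- by apply/RintegrableZl/integrable_gauss_kernel; rewrite mulr_gt0.
Qed.

Lemma measurable_cosR : measurable_fun [set: R] (@cos R).
Proof. apply: continuous_measurable_fun; exact: continuous_cos. Qed.

Lemma measurable_sinR : measurable_fun [set: R] (@sin R).
Proof. apply: continuous_measurable_fun; exact: continuous_sin. Qed.

Lemma is_derive_gauss_sin (b s t x : R) : b != 0 ->
  is_derive x 1 (fun x : R => gauss_kernel b x * sin (s * x + t) : R)
    (s * (gauss_kernel b x * cos (s * x + t)) -
     2 / b * (x * gauss_kernel b x * sin (s * x + t))).
Proof.
move=> b0.
have d1 : is_derive x 1 (gauss_kernel b) (gauss_kernel b x * - (2 * x / b)).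
  apply: (@is_derive1_comp _ expR (fun y => - (y ^+ 2 / b))).
  by apply: is_derive_eq; rewrite /GRing.scale/=; field.
have d2 : is_derive x 1 (fun y : R => sin (s * y + t)) (cos (s * x + t) * s).
  apply: (@is_derive1_comp _ sin (fun y => s * y + t)).
  by apply: is_derive_eq; rewrite /GRing.scale/=; ring.
by apply: is_derive_eq; rewrite /GRing.scale/=; field.
Qed.

Lemma continuous_gauss_kernel (b : R) : continuous (gauss_kernel b).
Proof.
move=> x; apply: (cvg_comp (fun y => - (y ^+ 2 / b)) expR); last exact: continuous_expR.
apply: (@cvgN _ R^o); apply: cvgM; last exact: cvg_cst.
exact: exprn_continuous.
Qed.

Lemma cvg_gauss_kernel (b : R) : 0 < b -> gauss_kernel b n%:R @[n --> \oo] --> (0 : R).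
Proof.
move=> b0; apply/cvgrPdist_le => e e0.
near=> n; rewrite sub0r normrN ger0_norm ?expR_ge0//.
rewrite /gauss_kernel expRN invf_ple ?posrE ?expR_gt0 ?invr_gt0//.
apply: le_trans (expR_ge1Dx _).
rewrite -[leLHS]add0r lerD// ler_pdivlMr//.
apply: (@le_trans _ _ n%:R).
  by near: n; exact: nbhs_infty_ger.
rewrite -natrX ler_nat -{1}(expn1 n) leq_pexp2l//.
by near: n; exact: nbhs_infty_gt.
Unshelve. all: by end_near. Qed.

Lemma integrable_gauss_cos (b s t : R) : 0 < b ->
  leb.-integrable setT (EFin \o (fun x => gauss_kernel b x * cos (s * x + t))).
Proof.
move=> b0; apply: (le_integrable _ _ _ (integrable_gauss_kernel b0)) => //.
  apply/measurable_EFinP; apply: measurable_funM; first exact: measurable_gauss_kernel.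
  apply: (measurableT_comp measurable_cosR).
  by apply: measurable_funD => //; exact: measurable_funM.
move=> x _; rewrite /= lee_fin normrM ler_piMr//.
exact: cos_max.
Qed.

Lemma integrable_x_gauss_sin (b s t : R) : 0 < b ->
  leb.-integrable setT (EFin \o (fun x => x * gauss_kernel b x * sin (s * x + t))).
Proof.
move=> b0; apply: (le_integrable _ _ _ (integrable_normr_gauss_kernel b0)) => //.
  apply/measurable_EFinP; apply: measurable_funM.
    by apply: measurable_funM => //; exact: measurable_gauss_kernel.
  apply: (measurableT_comp measurable_sinR).
  by apply: measurable_funD => //; exact: measurable_funM.
move=> x _; rewrite /= lee_fin [leRHS]normrM normr_id -normrM [leLHS]normrM.
by rewrite ler_piMr// sin_max.
Qed.

(** The difference of the two sides is the integral of the derivative of [F], and [F] vanishes at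
    both infinities. The fundamental theorem of calculus is applied on growing intervals and
    dominated convergence passes to the whole line. *)
Lemma Rintegral_gauss_by_parts (b s t : R) : 0 < b ->
  s * (\int[leb]_x (gauss_kernel b x * cos (s * x + t))) =
  2 / b * (\int[leb]_x (x * gauss_kernel b x * sin (s * x + t))).
Proof.
move=> b0; have bn0 : b != 0 by rewrite gt_eqF.
pose F (x : R) := gauss_kernel b x * sin (s * x + t).
pose f x := s * (gauss_kernel b x * cos (s * x + t)) -
     2 / b * (x * gauss_kernel b x * sin (s * x + t)).
have dF x : is_derive (x : R) 1 F (f x) by exact: is_derive_gauss_sin.
have i1 := RintegrableZl s (integrable_gauss_cos s t b0).
have i2 := RintegrableZl (2 / b) (integrable_x_gauss_sin s t b0).
have if_ : leb.-integrable setT (EFin \o f) := RintegrableB i1 i2.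
have cont_lin : continuous (fun x : R => s * x + t).
  by move=> y; apply: cvgD; [apply: cvgM; [exact: cvg_cst|exact: cvg_id]|exact: cvg_cst].
have cf : continuous f.
  move=> x; apply: cvgB.
    apply: cvgM; first exact: cvg_cst.
    apply: cvgM; first exact: continuous_gauss_kernel.
    by apply: (cvg_comp (fun x => s * x + t) cos); [exact: cont_lin|exact: continuous_cos].
  apply: cvgM; first exact: cvg_cst.
  apply: cvgM; last first.
    by apply: (cvg_comp (fun x => s * x + t) sin); [exact: cont_lin|exact: continuous_sin].
  apply: cvgM; first exact: cvg_id.
  exact: continuous_gauss_kernel.
have cF : continuous F.
  move=> x; apply: cvgM; first exact: continuous_gauss_kernel.
  by apply: (cvg_comp (fun x => s * x + t) sin); [exact: cont_lin|exact: continuous_sin].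
(* The successor keeps the interval nondegenerate at [n = 0]. *)
have FTC (n : nat) : (\int[leb]_(x in `[(- n.+1%:R)%R, n.+1%:R%R]) (f x)%:E = (F n.+1%:R - F (- n.+1%:R))%R%:E)%E.
  rewrite EFinB; apply: continuous_FTC2.
  - by rewrite -subr_gt0 opprK addr_gt0.
  - exact: continuous_subspaceT.
  - split.
    + by move=> x _; have [] := dF x.
    + by apply: cvg_at_right_filter; exact: cF.
    + by apply: cvg_at_left_filter; exact: cF.
  - by move=> x _; rewrite derive1E; have [] := dF x.
suff : \int[leb]_x f x = 0.
  rewrite /f RintegralB// !RintegralZl//; try exact: integrable_gauss_cos.
    by move/eqP; rewrite subr_eq0 => /eqP.
  exact: integrable_x_gauss_sin.
pose I (n : nat) : set R := [set` `[(- n.+1%:R)%R, n.+1%:R%R]].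
pose fn (n : nat) := (EFin \o f) \_ (I n).
have mI n : measurable (I n) by exact: measurable_itv.
have /(_ _ _ _ _ _)[|||||_ _] // := @dominated_convergence _ _ _ leb setT measurableT fn (EFin \o f) (abse \o (EFin \o f)).
- move=> n; apply/(measurable_restrictT _ (mI n)).
  by apply: measurable_funTS; exact: measurable_int if_.
- exact: measurable_int if_.
- apply: aeW => x _; apply: cvg_near_cst; near=> n.
  rewrite /fn patchE mem_set// /I /= in_itv/=.
  rewrite -ler_norml; apply: (@le_trans _ _ n%:R); last by rewrite ler_nat.
  by near: n; exact: nbhs_infty_ger.
- exact: integrable_abse.
- apply: aeW => x n _; rewrite /fn patchE; case: ifP => _ //=.
  by rewrite normr0 lee_fin.
rewrite (_ : [sequence _]_n = (fun n => (F n.+1%:R - F (- n.+1%:R))%:E)); last first.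
  by apply/funext => n; rewrite /= -FTC /fn -integral_mkcond.
move=> cvf.
have G0 : F n.+1%:R - F (- n.+1%:R) @[n --> \oo] --> (0 : R).
  have cG := cvg_gauss_kernel b0; rewrite -(cvg_shiftS) in cG.
  rewrite -(subr0 (0 : R)); apply: cvgB.
    apply/norm_cvg0P; apply: (squeeze_cvgr _ (cvg_cst 0) cG).
    near=> n; rewrite normr_ge0/= /F normrM ger0_norm ?gauss_kernel_ge0//.
    by rewrite ler_piMr ?sin_max// gauss_kernel_ge0.
  apply/norm_cvg0P; apply: (squeeze_cvgr _ (cvg_cst 0) cG).
  near=> n; rewrite normr_ge0/= /F normrM ger0_norm ?gauss_kernel_ge0//.
  by rewrite {1}/gauss_kernel sqrrN ler_piMr ?sin_max// expR_ge0.
have cv0 : (F n.+1%:R - F (- n.+1%:R))%:E @[n --> \oo] --> (0%:E : \bar R).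
  by apply: cvg_EFin => //; exact: nearW.
by rewrite /Rintegral (cvg_unique _ cvf cv0).
Unshelve. all: by end_near. Qed.

(** Differentiating under the integral brings down a factor [- x] and turns the cosine into a sine;
    integration by parts then returns the original integral times [s]. The result is the linear
    differential equation that characterizes a Gaussian. *)
Lemma is_derive_gauss_cos (b t s : R) : 0 < b ->
  is_derive s 1 (fun s : R => \int[leb]_x (gauss_kernel b x * cos (s * x + t)) : R)
    (- (b / 2 * s) * \int[leb]_x (gauss_kernel b x * cos (s * x + t))).
Proof.
move=> b0.
pose f (s x : R) := gauss_kernel b x * cos (s * x + t).
have df (s0 x : R) : is_derive s0 1 (f^~ x) (- (x * gauss_kernel b x * sin (s0 * x + t))).
  have d2 : is_derive s0 1 (fun y : R => cos (y * x + t)) (- sin (s0 * x + t) * x).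
    apply: (@is_derive1_comp _ cos (fun y => y * x + t)).
    by apply: is_derive_eq; rewrite /GRing.scale/=; ring.
  by apply: is_derive_eq; rewrite /GRing.scale/=; ring.
have pf s0 x : partial1of2 f s0 x = - (x * gauss_kernel b x * sin (s0 * x + t)).
  by rewrite /partial1of2 derive1E; have [_] := df s0 x.
(* The limit of the difference quotient gives both halves of the claim, derivability and the value
   of the derivative. *)
suff cvd : h^-1 *: (\int[leb]_y f (h + s) y - \int[leb]_y f s y) @[h --> 0^'] -->
    (- (b / 2 * s) * \int[leb]_x (gauss_kernel b x * cos (s * x + t))).
  have [der _] : derivable (fun s : R => \int[leb]_x (gauss_kernel b x * cos (s * x + t)) : R) s 1 /\ True.
    split=> //; apply/cvg_ex; eexists.
    by under eq_fun do rewrite scaler1; exact: cvd.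
  apply: DeriveDef => //; rewrite -derive1E.
  exact/cvg_lim/cvd.
have E : \int[leb]_x partial1of2 f s x =
    - (b / 2 * s) * \int[leb]_x (gauss_kernel b x * cos (s * x + t)).
  transitivity (- (b / 2 * (s * \int[leb]_x (gauss_kernel b x * cos (s * x + t))))); last by ring.
  rewrite Rintegral_gauss_by_parts// mulrA.
  have -> : b / 2 * (2 / b) = 1 by field; rewrite gt_eqF.
  rewrite mul1r -mulN1r -RintegralZl//; last exact: integrable_x_gauss_sin.
  by apply: eq_Rintegral => x _; rewrite pf mulN1r.
rewrite -E.
apply: (@cvg_differentiation_under_integral R _ _ leb f setT measurableT s (s - 1) (s + 1) _ _ _
  (fun x => `|x| * gauss_kernel b x) _ (integrable_normr_gauss_kernel b0) _).
- by rewrite /= in_itv/= ltrBlDr !ltrDl ltr01.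
- by move=> x _; exact: integrable_gauss_cos.
- by move=> x y _ _; have [] := df x y.
- by move=> y; rewrite mulr_ge0// gauss_kernel_ge0.
- move=> x y _ _; rewrite pf normrN normrM normrM (ger0_norm (gauss_kernel_ge0 _ _)).
  by rewrite ler_piMr ?sin_max// mulr_ge0// gauss_kernel_ge0.
Qed.

(** Multiplying by the integrating factor [expR (b / 4 * s ^ 2)] gives a function of zero
    derivative, so its value at [s] is its value at 0. The free phase [t] serves twice later: it
    collects the other coordinates when the dimension grows, and [t = - pi / 2] turns the cosine
    into a sine. *)
Lemma Rintegral_gauss_cos (b t s : R) : 0 < b ->
  \int[leb]_x (gauss_kernel b x * cos (s * x + t)) =
  Num.sqrt (b * pi) * expR (- (b / 4 * s ^+ 2)) * cos t.
Proof.
move=> b0.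
pose F (s : R) : R := \int[leb]_x (gauss_kernel b x * cos (s * x + t)).
pose H (s : R) : R := expR (b / 4 * s ^+ 2) * F s.
have dH (x : R) : is_derive x 1 H 0.
  have dF : is_derive x 1 F (- (b / 2 * x) * F x) := is_derive_gauss_cos t x b0.
  have de : is_derive x 1 (fun x : R => expR (b / 4 * x ^+ 2)) (expR (b / 4 * x ^+ 2) * (b / 2 * x)).
    apply: (@is_derive1_comp _ expR (fun y => b / 4 * y ^+ 2)).
    by apply: is_derive_eq; rewrite /GRing.scale/=; field.
  by apply: is_derive_eq; rewrite /GRing.scale/=; field.
have := is_derive_0_is_cst s 0 dH.
rewrite /H expr0n/= mulr0 expR0 mul1r => HF.
have F0 : F 0 = Num.sqrt (b * pi) * cos t.
  rewrite /F; under eq_Rintegral do rewrite mul0r add0r.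
  rewrite RintegralZr//; last exact: integrable_gauss_kernel.
  by rewrite /Rintegral integral_gauss_kernel.
rewrite -/(F s) -mulrA [_ * cos t]mulrC mulrA -F0 -HF mulrAC -expRD.
by rewrite subrr expR0 mul1r.
Qed.

End gauss1.

(** A pushforward is a measure only along a measurability proof; taking that proof as an argument
    lets the bundled measure be named in changes of variables. *)
Definition image_measure d1 d2 (T1 : measurableType d1) (T2 : measurableType d2)
    (R : realType) (m : {measure set T1 -> \bar R}) (f : T1 -> T2)
    (mf : measurable_fun setT f) : {measure set T2 -> \bar R} :=
  measure_function_pushforward__canonical__measure_function_Measure m mf.

(** * Lebesgue measure on [d.-tuple R]: affine changes of variables and Gaussian integrals *)

Section lebesgue_vec_theory.
Context {R : realType}.
Local Notation leb := (@lebesgue_measure R).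

Lemma measurable_affine (c t : R) :
  measurable_fun setT (fun x : R => c * x + t : measurableTypeR R).
Proof. by apply: measurable_funD => //; exact: measurable_funM. Qed.

(** The right-hand side is a measure in [A], a scaled pushforward, and it agrees with Lebesgue
    measure on half-open intervals, which determines it. *)
Lemma lebesgue_measure_affine (c t : R) (A : set R) : 0 < c -> measurable A ->
  (leb A = c%:E * leb ((fun x => (c * x + t)%R) @^-1` A))%E.
Proof.
move=> c0 mA.
have mphi := measurable_affine c t.
pose m : {measure set (measurableTypeR R) -> \bar R} :=
  mscale (NngNum (ltW c0)) (image_measure leb mphi).
apply: (lebesgue_measure_unique (mu := m)) => //.
move=> X [[a b] _ <-] /=.
rewrite /m /mscale/= /pushforward.
rewrite (_ : _ @^-1` _ = `](a - t) / c, (b - t) / c]%classic).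
  rewrite !lebesgue_measure_itv/= !lte_fin ltr_pM2r ?invr_gt0// ltrD2r.
  case: ifP => _; last by rewrite mule0.
  by rewrite -!EFinD -EFinM; congr EFin; field; rewrite gt_eqF.
apply/seteqP; split => x /=; rewrite !in_itv/= ltr_pdivrMr// ler_pdivlMr// ltrBlDr lerBrDr mulrC//.
Qed.

Lemma ge0_integral_affine (c t : R) (f : R -> \bar R) : 0 < c ->
  measurable_fun setT f -> (forall x, (0 <= f x)%E) ->
  (\int[leb]_x f x = c%:E * \int[leb]_x f (c * x + t)%R)%E.
Proof.
move=> c0 mf f0.
have mphi := measurable_affine c t.
transitivity (\int[mscale (NngNum (ltW c0)) (image_measure leb mphi)]_x f x)%E.
  apply: eq_measure_integral => A mA _.
  exact: (lebesgue_measure_affine t c0 mA).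
by rewrite ge0_integral_mscale//= ge0_integral_pushforward.
Qed.

Lemma ge0_integral_lebesgue_vecS d (f : d.+1.-tuple R -> \bar R) :
  measurable_fun setT f -> (forall x, (0 <= f x)%E) ->
  (\int[@lebesgue_vec R d.+1]_x f x =
   \int[leb]_x \int[@lebesgue_vec R d]_y f (tcons (x, y)))%E.
Proof.
move=> mf f0; have mt := @measurable_tcons R d.
transitivity (\int[image_measure (leb \x @lebesgue_vec R d)%E mt]_x f x)%E.
  exact: eq_measure_integral.
rewrite ge0_integral_pushforward// preimage_setT fubini_tonelli1//.
- exact: measurableT_comp.
- by move=> z; exact: f0.
Qed.

Lemma integral_lebesgue_vecS d (f : d.+1.-tuple R -> \bar R) :
  (@lebesgue_vec R d.+1).-integrable setT f ->
  (\int[@lebesgue_vec R d.+1]_x f x =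
   \int[leb]_x \int[@lebesgue_vec R d]_y f (tcons (x, y)))%E.
Proof.
move=> intf; have mt := @measurable_tcons R d.
have mf := measurable_int _ intf.
have mft : measurable_fun setT (f \o (@tcons R d)) by exact: measurableT_comp.
have intft : (leb \x @lebesgue_vec R d)%E.-integrable setT (f \o (@tcons R d)).
  apply/integrableP; split=> //.
  have /integrableP[_] := intf.
  rewrite ge0_integral_lebesgue_vecS//; last exact: measurableT_comp.
  rewrite fubini_tonelli1//; exact: measurableT_comp.
transitivity (\int[image_measure (leb \x @lebesgue_vec R d)%E mt]_x f x)%E.
  exact: eq_measure_integral.
rewrite integral_pushforward// preimage_setT.
by rewrite -integral12_prod_meas1.
Qed.

Lemma tnth_behead_lift (T : Type) d (l : d.+1.-tuple T) (i : 'I_d) :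
  tnth [tuple of behead l] i = tnth l (lift ord0 i).
Proof.
rewrite tnth_behead; congr (tnth l _); apply: val_inj.
by rewrite /= inordK// ltnS.
Qed.

Lemma measurable_tnth_comp d0 (T : measurableType d0) d (f : T -> d.-tuple R) i :
  measurable_fun setT f -> measurable_fun setT (fun x => tnth (f x) i).
Proof. by move=> mf; apply: (measurableT_comp (measurable_tnth i)). Qed.

Lemma measurable_vadd d0 (T : measurableType d0) d (f g : T -> d.-tuple R) :
  measurable_fun setT f -> measurable_fun setT g ->
  measurable_fun setT (fun x => vadd (f x) (g x)).
Proof.
move=> mf mg; apply/measurable_fun_tnthP => i.
rewrite (_ : _ \o _ = fun x => tnth (f x) i + tnth (g x) i); last first.
  by apply/funext => x /=; rewrite tnth_mktuple.
by apply: measurable_funD; exact: measurable_tnth_comp.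
Qed.

Lemma measurable_vscale d0 (T : measurableType d0) d (c : R) (f : T -> d.-tuple R) :
  measurable_fun setT f -> measurable_fun setT (fun x => vscale c (f x)).
Proof.
move=> mf; apply/measurable_fun_tnthP => i.
rewrite (_ : _ \o _ = fun x => c * tnth (f x) i); last first.
  by apply/funext => x /=; rewrite tnth_mktuple.
by apply: measurable_funM => //; exact: measurable_tnth_comp.
Qed.

Lemma measurable_inner d0 (T : measurableType d0) d (f g : T -> d.-tuple R) :
  measurable_fun setT f -> measurable_fun setT g ->
  measurable_fun setT (fun x => inner (f x) (g x)).
Proof.
move=> mf mg; apply: measurable_sum => i.
by apply: measurable_funM; exact: measurable_tnth_comp.
Qed.

Lemma inner_ge0 d (x : d.-tuple R) : 0 <= inner x x.
Proof. by apply: sumr_ge0 => i _; rewrite -expr2 sqr_ge0. Qed.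

Lemma enorm_sq d (x : d.-tuple R) : enorm x ^+ 2 = inner x x.
Proof. by rewrite sqr_sqrtr// inner_ge0. Qed.

Lemma innerC d (x y : d.-tuple R) : inner x y = inner y x.
Proof. by apply: eq_bigr => i _; rewrite mulrC. Qed.

Lemma inner_addl d (x y l : d.-tuple R) : inner (vadd x y) l = inner x l + inner y l.
Proof.
by rewrite -big_split; apply: eq_bigr => i _; rewrite tnth_mktuple mulrDl.
Qed.

Lemma inner_scalel d c (x l : d.-tuple R) : inner (vscale c x) l = c * inner x l.
Proof.
by rewrite mulr_sumr; apply: eq_bigr => i _; rewrite tnth_mktuple mulrA.
Qed.

Lemma inner_tcons d (x : R) (y : d.-tuple R) (l : d.+1.-tuple R) :
  inner (tcons (x, y)) l = x * thead l + inner y [tuple of behead l].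
Proof.
rewrite /inner big_ord_recl; congr (_ + _).
by apply: eq_bigr => i _; rewrite tnthS tnth_behead_lift.
Qed.

Lemma affine_tcons d c (x : R) (y : d.-tuple R) (t : d.+1.-tuple R) :
  vadd (vscale c (tcons (x, y))) t =
  tcons (c * x + thead t, vadd (vscale c y) [tuple of behead t]).
Proof.
apply: eq_from_tnth => i; case: (unliftP ord0 i) => [j ->|->].
  by rewrite tnthS !tnth_mktuple tnthS tnth_behead_lift.
by rewrite !tnth_mktuple.
Qed.

Lemma measurable_affine_vec d c (t : d.-tuple R) :
  measurable_fun setT (fun x : d.-tuple R => vadd (vscale c x) t).
Proof. by apply: measurable_vadd => //; exact: measurable_vscale. Qed.

(** Induction on [d]: the tail coordinates are transformed by the induction hypothesis, the head by
    the one-dimensional formula, each contributing its power of [c]. Translations and dilations are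
    both instances. *)
Lemma ge0_integral_affine_vec d (c : R) (t : d.-tuple R) (f : d.-tuple R -> \bar R) :
  0 < c -> measurable_fun setT f -> (forall x, (0 <= f x)%E) ->
  (\int[@lebesgue_vec R d]_x f x =
   (c ^+ d)%:E * \int[@lebesgue_vec R d]_x f (vadd (vscale c x) t))%E.
Proof.
move=> c0; elim: d t f => [|d IH] t f mf f0.
  by rewrite expr0 mul1e; apply: eq_integral => x _; congr f; apply: eq_from_tnth => -[].
have mA := measurable_affine_vec c t.
have mA' := measurable_affine_vec c [tuple of behead t].
have mf2 (g : d.+1.-tuple R -> \bar R) : measurable_fun setT g -> measurable_fun setT (g \o @tcons R d).
  by move=> mg; apply: measurableT_comp => //; exact: measurable_tcons.
rewrite ge0_integral_lebesgue_vecS// ge0_integral_lebesgue_vecS//; last first.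
  exact: measurableT_comp.
under eq_integral => x _.
  rewrite (IH [tuple of behead t])//; last first.
    exact/(measurableT_comp (mf2 _ mf))/pair1_measurable.
  over.
pose G (z : R * d.-tuple R) := f (tcons (z.1, vadd (vscale c z.2) [tuple of behead t])).
have mG : measurable_fun setT G.
  apply: (measurableT_comp (mf2 _ mf)).
  apply/measurable_fun_pairP; split; first exact: measurable_fst.
  by apply: measurable_vadd => //; apply: measurable_vscale; exact: measurable_snd.
have mFG : measurable_fun setT (fun x => \int[lebesgue_vec (d:=d)]_y G (x, y))%E.
  by apply: (measurable_integral_snd (@lebesgue_vec R d) mG) => z; exact: f0.
have G0 x : (0 <= \int[lebesgue_vec (d:=d)]_y G (x, y))%E.
  by apply: integral_ge0 => y _; exact: f0.
transitivity ((c ^+ d)%:E * \int[leb]_x \int[lebesgue_vec (d:=d)]_y G (x, y))%E.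
  have cd0 : 0 <= c ^+ d by rewrite exprn_ge0// ltW.
  exact: (@ge0_integralZl_EFin _ _ R leb setT measurableT
    (fun x : R => \int[lebesgue_vec (d:=d)]_y G (x, y))%E (fun x _ => G0 x) mFG _ cd0).
rewrite (ge0_integral_affine (thead t) c0 mFG G0).
rewrite muleA -EFinM -exprSr; congr (_ * _)%E.
by apply: eq_integral => x _; apply: eq_integral => y _; rewrite affine_tcons.
Qed.

Lemma integral_lebesgue_vec0 (f : 0.-tuple R -> \bar R) :
  (\int[@lebesgue_vec R 0]_x f x = f [tuple])%E.
Proof.
have -> : f = cst (f [tuple]) by apply/funext => x; rewrite (tuple0 x).
transitivity (\int[\d_([tuple] : 0.-tuple R)]_x cst (f [tuple]) x)%E.
  exact: eq_measure_integral.
by rewrite integral_dirac// diracT mul1e.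
Qed.

Lemma gauss_density_tcons d (b x : R) (y : d.-tuple R) : 0 < b ->
  gauss_density b (tcons (x, y)) =
  (Num.sqrt (b * pi))^-1 * gauss_kernel b x * gauss_density b y.
Proof.
move=> b0; have bp : 0 < b * pi by rewrite mulr_gt0// pi_gt0.
rewrite /gauss_density /gauss_kernel !enorm_sq.
have -> : inner (tcons (x, y)) (tcons (x, y)) = x ^+ 2 + inner y y.
  rewrite inner_tcons expr2; congr (_ + inner y _).
  exact/val_inj.
have -> : - (d.+1%:R / 2 : R) = - 2^-1 + - (d%:R / 2) by rewrite -natr1; field.
rewrite powRD; last by rewrite (gt_eqF bp) implybT.
rewrite powRN powR12_sqrt ?ltW// mulrDl opprD expRD.
by rewrite -!mulrA; congr (_ * _); rewrite mulrCA.
Qed.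

Lemma gauss_density_ge0 d (b : R) (x : d.-tuple R) : 0 <= gauss_density b x.
Proof. by rewrite mulr_ge0 ?powR_ge0 ?expR_ge0. Qed.

Lemma measurable_gauss_density d (b : R) : measurable_fun setT (@gauss_density R d b).
Proof.
apply: measurable_funM => //; apply: measurableT_comp => //.
apply: measurableT_comp => //; apply: measurable_funM => //.
rewrite (_ : (fun x => _) = (fun x : d.-tuple R => inner x x)).
  exact: measurable_inner.
by apply/funext => x; exact: enorm_sq.
Qed.

Lemma integral_gauss_density d (b : R) : 0 < b ->
  (\int[@lebesgue_vec R d]_x (gauss_density b x)%:E = 1)%E.
Proof.
move=> b0; have sbp : 0 < Num.sqrt (b * pi) by rewrite sqrtr_gt0 mulr_gt0// pi_gt0.
elim: d => [|d IH].
  rewrite integral_lebesgue_vec0 /gauss_density enorm_sq /inner big_ord0.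
  by rewrite !mul0r oppr0 powRr0 expR0 mul1r.
rewrite ge0_integral_lebesgue_vecS; last 2 first.
  by apply/measurable_EFinP; exact: measurable_gauss_density.
  by move=> x; rewrite lee_fin gauss_density_ge0.
transitivity (\int[leb]_x ((Num.sqrt (b * pi))^-1%:E * (gauss_kernel b x)%:E))%E.
  apply: eq_integral => x _.
  under eq_integral do rewrite gauss_density_tcons// EFinM.
  rewrite ge0_integralZl_EFin//.
  - by rewrite IH mule1 EFinM.
  - by move=> y _; rewrite lee_fin gauss_density_ge0.
  - by apply/measurable_EFinP; exact: measurable_gauss_density.
  - by rewrite mulr_ge0 ?gauss_kernel_ge0 ?invr_ge0 ?ltW.
rewrite ge0_integralZl_EFin//.
- by rewrite integral_gauss_kernel// -EFinM mulVf// gt_eqF.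
- by move=> y _; rewrite lee_fin gauss_kernel_ge0.
- by apply/measurable_EFinP; exact: measurable_gauss_kernel.
Qed.

Lemma integrable_gauss_density d (b : R) : 0 < b ->
  (@lebesgue_vec R d).-integrable setT (EFin \o gauss_density b).
Proof.
move=> b0; apply/integrableP; split.
  by apply/measurable_EFinP; exact: measurable_gauss_density.
under eq_integral do rewrite /= ger0_norm ?gauss_density_ge0//.
by rewrite integral_gauss_density// ltry.
Qed.

Lemma measurable_cos_inner d0 (T : measurableType d0) d (l : d.-tuple R) (t : R)
    (f : T -> d.-tuple R) : measurable_fun setT f ->
  measurable_fun setT (fun x => cos (2 * pi * inner (f x) l + t)).
Proof.
move=> mf; apply: (measurableT_comp measurable_cosR).
by apply: measurable_funD => //; apply: measurable_funM => //; exact: measurable_inner.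
Qed.

Lemma integrable_gauss_density_cos d (b t : R) (l : d.-tuple R) : 0 < b ->
  (@lebesgue_vec R d).-integrable setT
    (EFin \o (fun x => gauss_density b x * cos (2 * pi * inner x l + t))).
Proof.
move=> b0; apply: RintegrableM_le1; last exact: integrable_gauss_density.
  exact: measurable_cos_inner.
by move=> x; exact: cos_max.
Qed.

(** The induction on [d] needs an arbitrary phase: with the head coordinate [x] frozen,
    [2 * pi * thead l * x] joins [t] as the phase of the remaining integral, and what is left is a
    one-dimensional Gaussian integral in [x]. *)
Lemma integral_gauss_density_cos d (b t : R) (l : d.-tuple R) : 0 < b ->
  (\int[@lebesgue_vec R d]_x (gauss_density b x * cos (2 * pi * inner x l + t))%:E =
   (expR (- (pi ^+ 2 * b * inner l l)) * cos t)%:E)%E.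
Proof.
move=> b0; have sbp : 0 < Num.sqrt (b * pi) by rewrite sqrtr_gt0 mulr_gt0// pi_gt0.
elim: d t l => [|d IH] t l.
  rewrite integral_lebesgue_vec0 /gauss_density enorm_sq /inner !big_ord0.
  by rewrite !(mul0r, mulr0) oppr0 powRr0 expR0 add0r mul1r.
rewrite integral_lebesgue_vecS; last exact: integrable_gauss_density_cos.
pose l' := [tuple of behead l].
pose c := (Num.sqrt (b * pi))^-1 * expR (- (pi ^+ 2 * b * inner l' l')).
transitivity (\int[leb]_x (c%:E * (gauss_kernel b x * cos (2 * pi * thead l * x + t))%:E))%E.
  apply: eq_integral => x _.
  transitivity (\int[lebesgue_vec (d:=d)]_y (((Num.sqrt (b * pi))^-1 * gauss_kernel b x)%:E *
     (gauss_density b y * cos (2 * pi * inner y l' + (2 * pi * thead l * x + t)))%:E))%E.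
    apply: eq_integral => y _.
    rewrite gauss_density_tcons// inner_tcons -/l' -EFinM; congr EFin; rewrite [RHS]mulrA; congr (_ * cos _).
    by ring.
  rewrite integralZl//; last exact: integrable_gauss_density_cos.
  by rewrite IH -!EFinM /c; congr EFin; ring.
rewrite integralZl//; last exact: integrable_gauss_cos.
rewrite -EFin_Rintegral; last exact: integrable_gauss_cos.
rewrite [X in (_ * X%:E)%E](Rintegral_gauss_cos t _ b0) -EFinM; congr EFin.
rewrite /c.
have -> : inner l l = thead l ^+ 2 + inner l' l'.
  rewrite /inner big_ord_recl expr2; congr (_ + _).
  by apply: eq_bigr => i _; rewrite tnth_behead_lift.
rewrite (mulrDr (pi ^+ 2 * b)) opprD expRD.
have -> : b / 4 * (2 * pi * thead l) ^+ 2 = pi ^+ 2 * b * thead l ^+ 2 by field.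
field; by rewrite gt_eqF.
Qed.

Lemma vscale1 d (x : d.-tuple R) : vscale 1 x = x.
Proof. by apply: eq_from_tnth => i; rewrite tnth_mktuple mul1r. Qed.

Lemma ge0_integral_translate d (t : d.-tuple R) (f : d.-tuple R -> \bar R) :
  measurable_fun setT f -> (forall x, (0 <= f x)%E) ->
  (\int[@lebesgue_vec R d]_x f (vadd x t) = \int[@lebesgue_vec R d]_x f x)%E.
Proof.
move=> mf f0; rewrite [RHS](ge0_integral_affine_vec t ltr01)// expr1n mul1e.
by apply: eq_integral => x _; rewrite vscale1.
Qed.

Lemma integral_translate d (t : d.-tuple R) (f : d.-tuple R -> \bar R) :
  measurable_fun setT f ->
  (\int[@lebesgue_vec R d]_x f (vadd x t) = \int[@lebesgue_vec R d]_x f x)%E.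
Proof.
move=> mf; rewrite [LHS]integralE [RHS]integralE.
congr (_ - _)%E.
  rewrite -(ge0_integral_translate t (f := f^\+%E))//; last exact: measurable_funepos.
  by apply: eq_integral => x _; rewrite !funeposE.
rewrite -(ge0_integral_translate t (f := f^\-%E))//; last exact: measurable_funeneg.
by apply: eq_integral => x _; rewrite !funenegE.
Qed.

Definition vsub d (x y : d.-tuple R) := vadd x (vscale (-1) y).

Lemma inner_subl d (x y l : d.-tuple R) : inner (vsub x y) l = inner x l - inner y l.
Proof. by rewrite inner_addl inner_scalel mulN1r. Qed.

Lemma measurable_vsub d0 (T : measurableType d0) d (f g : T -> d.-tuple R) :
  measurable_fun setT f -> measurable_fun setT g ->
  measurable_fun setT (fun x => vsub (f x) (g x)).
Proof. by move=> mf mg; apply: measurable_vadd => //; exact: measurable_vscale. Qed.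

Lemma gauss_density_vsubC d b (x y : d.-tuple R) :
  gauss_density b (vsub x y) = gauss_density b (vsub y x).
Proof.
rewrite /gauss_density !enorm_sq; suff -> : inner (vsub x y) (vsub x y) = inner (vsub y x) (vsub y x) by [].
by apply: eq_bigr => i _; rewrite !tnth_mktuple; ring.
Qed.

Lemma integral_gauss_density_vsub d b (x : d.-tuple R) : 0 < b ->
  (\int[@lebesgue_vec R d]_y (gauss_density b (vsub x y))%:E = 1)%E.
Proof.
move=> b0; under eq_integral do rewrite gauss_density_vsubC.
rewrite (ge0_integral_translate _ (f := fun y => (gauss_density b y)%:E)).
- exact: integral_gauss_density.
- by apply/measurable_EFinP; exact: measurable_gauss_density.
- by move=> y; rewrite lee_fin gauss_density_ge0.
Qed.

End lebesgue_vec_theory.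

(** * Bessel's inequality *)

Section bessel.
Context {R : realType} (d : nat).
Local Notation L := (@lebesgue_vec R d).
Implicit Types (f : d.-tuple R -> R) (l : d.-tuple R).

(** The transform is handled through two real integrals. The sine integral has the sign opposite to
    the imaginary part of [fourier], which disappears in the squared modulus [power_spectrum]. *)
Definition fourier_cos f l := \int[L]_x (f x * cos (2 * pi * inner x l)).
Definition fourier_sin f l := \int[L]_x (f x * sin (2 * pi * inner x l)).
Definition power_spectrum f l := fourier_cos f l ^+ 2 + fourier_sin f l ^+ 2.

Lemma power_spectrum_ge0 f l : 0 <= power_spectrum f l.
Proof. by rewrite addr_ge0 ?sqr_ge0. Qed.

Lemma measurable_sin_inner d0 (T : measurableType d0) (l g : T -> d.-tuple R) :
  measurable_fun setT l -> measurable_fun setT g ->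
  measurable_fun setT (fun x => sin (2 * pi * inner (g x) (l x))).
Proof.
move=> ml mg; apply: (measurableT_comp measurable_sinR).
by apply: measurable_funM => //; exact: measurable_inner.
Qed.

Lemma measurable_cos_inner2 d0 (T : measurableType d0) (l g : T -> d.-tuple R) :
  measurable_fun setT l -> measurable_fun setT g ->
  measurable_fun setT (fun x => cos (2 * pi * inner (g x) (l x))).
Proof.
move=> ml mg; apply: (measurableT_comp measurable_cosR).
by apply: measurable_funM => //; exact: measurable_inner.
Qed.

Lemma integrable_fourier_cos f l : L.-integrable setT (EFin \o f) ->
  L.-integrable setT (EFin \o (fun x => f x * cos (2 * pi * inner x l))).
Proof.
move=> intf; apply: RintegrableM_le1 => //; first exact: measurable_cos_inner2.
by move=> x; exact: cos_max.
Qed.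

Lemma integrable_fourier_sin f l : L.-integrable setT (EFin \o f) ->
  L.-integrable setT (EFin \o (fun x => f x * sin (2 * pi * inner x l))).
Proof.
move=> intf; apply: RintegrableM_le1 => //; first exact: measurable_sin_inner.
by move=> x; exact: sin_max.
Qed.

Lemma normc_fourier f l : L.-integrable setT (EFin \o f) ->
  ComplexField.Normc.normc (fourier f l) ^+ 2 = power_spectrum f l.
Proof.
move=> intf; rewrite /fourier /Cintegral /= sqr_sqrtr ?addr_ge0 ?sqr_ge0//.
congr (_ ^+ 2 + _).
  by apply: eq_Rintegral => x _; rewrite cosN; ring.
transitivity ((- 1 * fourier_sin f l) ^+ 2); last by rewrite mulN1r sqrrN.
congr (_ ^+ 2); rewrite -RintegralZl//; last exact: integrable_fourier_sin.
by apply: eq_Rintegral => x _; rewrite sinN; ring.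
Qed.

Lemma measurable_fourier_cos f : measurable_fun setT f -> measurable_fun setT (fourier_cos f).
Proof.
move=> mf; apply: (measurable_Rintegral_snd L (G := fun z => f z.2 * cos (2 * pi * inner z.2 z.1))).
apply: measurable_funM; first exact: measurableT_comp.
exact: measurable_cos_inner2.
Qed.

Lemma measurable_fourier_sin f : measurable_fun setT f -> measurable_fun setT (fourier_sin f).
Proof.
move=> mf; apply: (measurable_Rintegral_snd L (G := fun z => f z.2 * sin (2 * pi * inner z.2 z.1))).
apply: measurable_funM; first exact: measurableT_comp.
exact: measurable_sin_inner.
Qed.

Lemma measurable_power_spectrum f : measurable_fun setT f ->
  measurable_fun setT (power_spectrum f).
Proof.
move=> mf; apply: measurable_funD; apply: measurable_funX.
  exact: measurable_fourier_cos.
exact: measurable_fourier_sin.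
Qed.

(** A squared modulus is the transform times its conjugate, hence a double integral; the formula for
    the cosine of a difference merges the two squares. Integrability of [f] makes the double
    integral absolutely convergent. *)
Lemma power_spectrumE f l : L.-integrable setT (EFin \o f) ->
  ((power_spectrum f l)%:E =
   \int[L \x L]_z (f z.1 * f z.2 * cos (2 * pi * inner (vsub z.1 z.2) l))%:E)%E.
Proof.
move=> intf; have mf := Rintegrable_measurable intf.
have intff := integrable_prodM intf intf.
rewrite -(integral12_prod_meas1 (m1 := L) (m2 := L)
  (f := fun z => (f z.1 * f z.2 * cos (2 * pi * inner (vsub z.1 z.2) l))%:E)); last first.
  apply: RintegrableM_le1 => //; last by move=> z; exact: cos_max.
  by apply: measurable_cos_inner2 => //; exact: measurable_vsub.
have ic := integrable_fourier_cos l intf; have is_ := integrable_fourier_sin l intf.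
transitivity (\int[L]_x (fourier_cos f l * (f x * cos (2 * pi * inner x l)) +
   fourier_sin f l * (f x * sin (2 * pi * inner x l)))%:E)%E.
  rewrite -EFin_Rintegral; last by apply: RintegrableD; exact: RintegrableZl.
  rewrite RintegralD//; try exact: RintegrableZl.
  by rewrite !RintegralZl// -/(fourier_cos f l) -/(fourier_sin f l) -!expr2.
apply: eq_integral => x _; rewrite /fubini_F/=.
transitivity (\int[L]_y ((f x * cos (2 * pi * inner x l)) * (f y * cos (2 * pi * inner y l)) +
  (f x * sin (2 * pi * inner x l)) * (f y * sin (2 * pi * inner y l)))%:E)%E.
  rewrite -EFin_Rintegral; last by apply: RintegrableD; exact: RintegrableZl.
  rewrite RintegralD//; try exact: RintegrableZl.
  rewrite !RintegralZl// -/(fourier_cos f l) -/(fourier_sin f l).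
  by congr EFin; ring.
apply: eq_integral => y _; congr EFin.
by rewrite inner_subl mulrBr cosB; ring.
Qed.

(** With [b' = (pi ^ 2 * b)^-1] the products [b * pi] and [b' * pi] are inverse to each other, so
    the two normalizing powers cancel. Written this way, the transform of a Gaussian is a multiple
    of a probability density, whose total mass 1 is what [gauss_bessel] uses. *)
Lemma gauss_density_dual (b : R) (v : d.-tuple R) : 0 < b ->
  expR (- (pi ^+ 2 * b * inner v v)) =
  (b * pi) `^ (- (d%:R / 2)) * gauss_density (pi ^+ 2 * b)^-1 v.
Proof.
move=> b0; have p0 : 0 < (pi : R) := pi_gt0 R.
rewrite /gauss_density enorm_sq invrK mulrA -powRM; last 2 first.
- by rewrite mulr_ge0// ltW.
- by rewrite mulr_ge0// ?ltW// invr_gt0 mulr_gt0// exprn_gt0.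
have -> : b * pi * ((pi ^+ 2 * b)^-1 * pi) = 1.
  by move: (pi : R) p0 => p p0; field; rewrite !gt_eqF.
by rewrite powR1 mul1r mulrC.
Qed.

(** The Gaussian weight makes the triple integrand in [l], [x], [y] absolutely integrable, so Fubini
    lets [l] be integrated first; this yields the transform of the weight at [x - y]. *)
Lemma integral_gauss_power_spectrum f (b : R) : 0 < b ->
  L.-integrable setT (EFin \o f) ->
  (\int[L]_l (gauss_density b l * power_spectrum f l)%:E =
   \int[L \x L]_z (f z.1 * f z.2 *
     expR (- (pi ^+ 2 * b * inner (vsub z.1 z.2) (vsub z.1 z.2))))%:E)%E.
Proof.
move=> b0 intf; have mf := Rintegrable_measurable intf.
have intff := integrable_prodM intf intf.
have intg := @integrable_gauss_density R d b b0.
have intgff := integrable_prodM (m2 := prod_measure L L) intg intff.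
pose H (w : d.-tuple R * (d.-tuple R * d.-tuple R)) := gauss_density b w.1 * (f w.2.1 * f w.2.2) * cos (2 * pi * inner (vsub w.2.1 w.2.2) w.1).
have intH : (L \x prod_measure L L)%E.-integrable setT (EFin \o H).
  apply: RintegrableM_le1 => //; last by move=> z; exact: cos_max.
  apply: measurable_cos_inner2 => //; apply: measurable_vsub.
    by apply: measurableT_comp => //; exact: measurable_fst.
  by apply: measurableT_comp => //; exact: measurable_snd.
have := Fubini (m1 := L) (m2 := prod_measure L L) intH.
rewrite [X in X = _ -> _](_ : _ = \int[L]_l (gauss_density b l * power_spectrum f l)%:E)%E; last first.
  apply: eq_integral => l _; rewrite EFinM power_spectrumE//.
  rewrite -integralZl//; last first.
    apply: RintegrableM_le1 => //; last by move=> z; exact: cos_max.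
    by apply: measurable_cos_inner2 => //; exact: measurable_vsub.
  by apply: eq_integral => z _; rewrite -EFinM /H/= !mulrA.
move=> ->; apply: eq_integral => z _.
transitivity (\int[L]_l ((f z.1 * f z.2)%:E * (gauss_density b l * cos (2 * pi * inner l (vsub z.1 z.2) + 0))%:E))%E.
  by apply: eq_integral => l _; rewrite -EFinM /H/= addr0 innerC; congr EFin; ring.
rewrite integralZl//; last exact: integrable_gauss_density_cos.
by rewrite integral_gauss_density_cos// cos0 mulr1.
Qed.

(** A Schur test: [|f x * f y|] is at most the half-sum of the squares, and the kernel [K] has mass
    1 in each variable separately. The factor [C] is also the peak of the weight on the left, so it
    cancels when the weight is normalized to height 1. *)
Lemma gauss_bessel f (b : R) : 0 < b -> L.-integrable setT (EFin \o f) ->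
  (\int[L]_l (gauss_density b l * power_spectrum f l)%:E <=
   ((b * pi) `^ (- (d%:R / 2)))%:E * \int[L]_x (f x ^+ 2)%:E)%E.
Proof.
move=> b0 intf; have mf := Rintegrable_measurable intf.
rewrite integral_gauss_power_spectrum//.
pose C := (b * pi) `^ (- (d%:R / 2)).
pose b' : R := (pi ^+ 2 * b)^-1.
have b'0 : 0 < b' by rewrite invr_gt0 mulr_gt0// exprn_gt0// pi_gt0.
pose K (z : d.-tuple R * d.-tuple R) := gauss_density b' (vsub z.1 z.2).
have K0 z : 0 <= K z by exact: gauss_density_ge0.
have mK : measurable_fun setT K.
  by apply: (measurableT_comp (measurable_gauss_density b')); exact: measurable_vsub.
have C0 : 0 <= C by exact: powR_ge0.
have mffK : measurable_fun setT (fun z : d.-tuple R * d.-tuple R => f z.1 * f z.2 * (C * K z)).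
  apply: measurable_funM; first by apply: measurable_funM; exact: measurableT_comp.
  exact: measurable_funM.
under eq_integral do rewrite gauss_density_dual// -/C -/b'.
apply: (le_trans (lee_abs _)); apply: (le_trans (le_abse_integral _ _ _)) => //.
  exact/measurable_EFinP.
have mU1 : measurable_fun setT (fun z => f z.1 ^+ 2 * K z).
  by apply: measurable_funM => //; apply: measurable_funX; exact: measurableT_comp.
have mU2 : measurable_fun setT (fun z => f z.2 ^+ 2 * K z).
  by apply: measurable_funM => //; apply: measurable_funX; exact: measurableT_comp.
apply: (@le_trans _ _ (\int[L \x L]_z ((C / 2)%:E * ((f z.1 ^+ 2 * K z)%:E + (f z.2 ^+ 2 * K z)%:E)))%E).
  apply: ge0_le_integral => //.
  - by apply: measurableT_comp => //; exact/measurable_EFinP.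
  - by apply: measurable_funeM; apply: emeasurable_funD; exact/measurable_EFinP.
  - move=> z _; rewrite -EFinD -EFinM /= lee_fin -/(K z) normrM.
    rewrite (ger0_norm (mulr_ge0 C0 (K0 z))) normrM.
    have -> : C / 2 * (f z.1 ^+ 2 * K z + f z.2 ^+ 2 * K z) =
      (f z.1 ^+ 2 + f z.2 ^+ 2) / 2 * (C * K z) by ring.
    apply: ler_wpM2r; first by rewrite mulr_ge0.
    rewrite -(real_normK (num_real (f z.1))) -(real_normK (num_real (f z.2))).
    have := sqr_ge0 (`|f z.1| - `|f z.2|); nra.
rewrite ge0_integralZl_EFin//; last 3 first.
- by move=> z _; rewrite adde_ge0// lee_fin mulr_ge0// sqr_ge0.
- by apply: emeasurable_funD; exact/measurable_EFinP.
- by rewrite divr_ge0.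
rewrite ge0_integralD//; last 4 first.
- by move=> z _; rewrite lee_fin mulr_ge0// sqr_ge0.
- exact/measurable_EFinP.
- by move=> z _; rewrite lee_fin mulr_ge0// sqr_ge0.
- exact/measurable_EFinP.
have -> : (\int[L \x L]_z (f z.1 ^+ 2 * K z)%:E = \int[L]_x (f x ^+ 2)%:E)%E.
  rewrite fubini_tonelli1; last 2 first.
  - exact/measurable_EFinP.
  - by move=> z; rewrite lee_fin mulr_ge0// sqr_ge0.
  apply: eq_integral => x _; rewrite /fubini_F/=.
  under eq_integral do rewrite EFinM.
  rewrite ge0_integralZl_EFin// ?sqr_ge0//.
  - by rewrite integral_gauss_density_vsub// mule1.
  - by move=> y _; rewrite lee_fin.
  - by apply/measurable_EFinP; exact: (measurableT_comp mK).
have -> : (\int[L \x L]_z (f z.2 ^+ 2 * K z)%:E = \int[L]_x (f x ^+ 2)%:E)%E.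
  rewrite fubini_tonelli2; last 2 first.
  - exact/measurable_EFinP.
  - by move=> z; rewrite lee_fin mulr_ge0// sqr_ge0.
  apply: eq_integral => x _; rewrite /fubini_G/=.
  under eq_integral do rewrite EFinM /K gauss_density_vsubC.
  rewrite ge0_integralZl_EFin// ?sqr_ge0//.
  - by rewrite integral_gauss_density_vsub// mule1.
  - by move=> y _; rewrite lee_fin gauss_density_ge0.
  - apply/measurable_EFinP; apply: (measurableT_comp (measurable_gauss_density b')).
    by apply: measurable_vsub => /=.
have I0 : (0 <= \int[L]_x (f x ^+ 2)%:E)%E.
  by apply: integral_ge0 => x _; rewrite lee_fin sqr_ge0.
rewrite -mule2n -mule_natl muleA -EFinM.
by have -> : C / 2 * 2%:R = C by field.
Qed.

(* Bessel's inequality, the only half of Plancherel's theorem that is needed. *)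
Lemma bessel_inequality f : L.-integrable setT (EFin \o f) ->
  (\int[L]_l (power_spectrum f l)%:E <= \int[L]_x (f x ^+ 2)%:E)%E.
Proof.
move=> intf; have mf := Rintegrable_measurable intf.
(* Gaussian weights of height 1 that increase to 1 as they widen, so that monotone convergence
   applies; the successor keeps the width positive. *)
pose g (n : nat) l := (gauss_kernel n.+1%:R (enorm l) * power_spectrum f l)%:E.
have mg n : measurable_fun setT (g n).
  apply/measurable_EFinP; apply: measurable_funM; last exact: measurable_power_spectrum.
  rewrite /gauss_kernel; apply: measurableT_comp => //; apply: measurableT_comp => //.
  apply: measurable_funM => //.
  by under eq_fun do rewrite enorm_sq; exact: measurable_inner.
have g0 n l : (0 <= g n l)%E.
  by rewrite lee_fin mulr_ge0// ?gauss_kernel_ge0// power_spectrum_ge0.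
have ndg l : {homo g^~ l : n m / (n <= m)%N >-> (n <= m)%E}.
  move=> n m nm; rewrite lee_fin ler_wpM2r// ?power_spectrum_ge0//.
  rewrite ler_expR lerN2 ler_wpM2l// ?sqr_ge0// lef_pV2 ?posrE// ler_nat.
  by rewrite ltnS.
have gl l : g n l @[n --> \oo] --> (power_spectrum f l)%:E.
  apply: cvg_EFin; first exact: nearW.
  rewrite -[X in _ --> X]mul1r; apply: cvgM; last exact: cvg_cst.
  have c1 : - (enorm l ^+ 2 / n.+1%:R) @[n --> \oo] --> (0 : R).
    rewrite -[X in _ --> X]oppr0; apply: cvgN.
    rewrite -[X in _ --> X](mulr0 (enorm l ^+ 2)); apply: cvgM; first exact: cvg_cst.
    exact: cvg_harmonic.
  have c2 := @continuous_expR R 0; rewrite /continuous_at expR0 in c2.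
  exact: cvg_comp c1 c2.
have gM n : (\int[L]_l g n l <= \int[L]_x (f x ^+ 2)%:E)%E.
  have n0 : 0 < n.+1%:R :> R by [].
  pose C : R := (n.+1%:R * pi) `^ (- (d%:R / 2)).
  have C0 : 0 < C by rewrite powR_gt0// mulr_gt0// pi_gt0.
  (* Multiplying the weight by [C] restores the density of [gauss_bessel], and [C] is exactly the
     constant on its right-hand side. *)
  rewrite -(lee_pmul2l (x := C%:E))//.
  apply: le_trans (gauss_bessel n0 intf).
  rewrite -ge0_integralZl_EFin//; last by rewrite ltW.
  rewrite le_eqVlt; apply/orP; left; apply/eqP; apply: eq_integral => l _.
  by rewrite -EFinM mulrA.
rewrite (_ : (\int[L]_l (power_spectrum f l)%:E = \int[L]_l limn (g^~ l))%E); last first.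
  by apply: eq_integral => l _; apply/esym/cvg_lim.
rewrite monotone_convergence//.
apply: lime_le; last exact: nearW.
apply: ereal_nondecreasing_is_cvgn => n m nm.
by apply: ge0_le_integral => // l _; exact: ndg.
Qed.

End bessel.

(** * Spectrum of a difference of translates *)

Section spectral.
Context {R : realType} (d : nat).
Local Notation L := (@lebesgue_vec R d).
Implicit Types (h : d.-tuple R -> R) (l s t : d.-tuple R).

Lemma integrable_translate h s : L.-integrable setT (EFin \o h) ->
  L.-integrable setT (EFin \o (fun y => h (vadd y s))).
Proof.
move=> /integrableP[mh inth]; apply/integrableP; split.
  by apply: (measurableT_comp mh); exact: measurable_vadd.
rewrite (integral_translate s (f := fun y => `|(h y)%:E|%E))//.
exact: measurableT_comp.
Qed.

(** After the change of variable the cosine is taken at a difference of angles: a translation by [s]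
    rotates the pair [(fourier_cos h l, fourier_sin h l)] by the angle [2 * pi * inner s l]. *)
Lemma fourier_cos_translate h s l : L.-integrable setT (EFin \o h) ->
  fourier_cos (fun y => h (vadd y s)) l =
  cos (2 * pi * inner s l) * fourier_cos h l +
  sin (2 * pi * inner s l) * fourier_sin h l.
Proof.
move=> inth; have mh := Rintegrable_measurable inth.
have ic := integrable_fourier_cos l inth; have is_ := integrable_fourier_sin l inth.
rewrite -!RintegralZl// -RintegralD//; try exact: RintegrableZl.
pose G y := (h y * cos (2 * pi * (inner y l - inner s l)))%:E.
rewrite /fourier_cos /Rintegral; congr fine.
transitivity (\int[L]_y G (vadd y s))%E.
  by apply: eq_integral => y _; rewrite /G inner_addl addrK.
rewrite integral_translate.
  by apply: eq_integral => y _; rewrite /G; congr EFin; rewrite mulrBr cosB; ring.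
apply/measurable_EFinP; apply: measurable_funM => //.
apply: (measurableT_comp measurable_cosR); apply: measurable_funM => //.
by apply: measurable_funB => //; exact: measurable_inner.
Qed.

Lemma fourier_sin_translate h s l : L.-integrable setT (EFin \o h) ->
  fourier_sin (fun y => h (vadd y s)) l =
  cos (2 * pi * inner s l) * fourier_sin h l -
  sin (2 * pi * inner s l) * fourier_cos h l.
Proof.
move=> inth; have mh := Rintegrable_measurable inth.
have ic := integrable_fourier_cos l inth; have is_ := integrable_fourier_sin l inth.
rewrite -!RintegralZl// -RintegralB//; try exact: RintegrableZl.
pose G y := (h y * sin (2 * pi * (inner y l - inner s l)))%:E.
rewrite /fourier_sin /Rintegral; congr fine.
transitivity (\int[L]_y G (vadd y s))%E.
  by apply: eq_integral => y _; rewrite /G inner_addl addrK.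
rewrite integral_translate.
  by apply: eq_integral => y _; rewrite /G; congr EFin; rewrite mulrBr sinB; ring.
apply/measurable_EFinP; apply: measurable_funM => //.
apply: (measurableT_comp measurable_sinR); apply: measurable_funM => //.
by apply: measurable_funB => //; exact: measurable_inner.
Qed.

(** This is the squared modulus of [exp(2 pi i s.l) - exp(2 pi i t.l)]. *)
Definition phase_gap l s t :=
  (cos (2 * pi * inner s l) - cos (2 * pi * inner t l)) ^+ 2 +
  (sin (2 * pi * inner s l) - sin (2 * pi * inner t l)) ^+ 2.

Lemma phase_gap_ge0 l s t : 0 <= phase_gap l s t.
Proof. by rewrite addr_ge0 ?sqr_ge0. Qed.

(** The difference has transform [h^] times the difference of two phases, and squared moduli
    multiply; in real coordinates the closing [ring] proves the two-squares identity. *)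
Lemma power_spectrum_difference h s t l : L.-integrable setT (EFin \o h) ->
  power_spectrum (fun y => h (vadd y s) - h (vadd y t)) l =
  power_spectrum h l * phase_gap l s t.
Proof.
move=> inth.
have is_ := integrable_translate s inth; have it := integrable_translate t inth.
rewrite /power_spectrum.
have -> : fourier_cos (fun y => h (vadd y s) - h (vadd y t)) l =
    fourier_cos (fun y => h (vadd y s)) l - fourier_cos (fun y => h (vadd y t)) l.
  rewrite -RintegralB//; try exact: integrable_fourier_cos.
  by apply: eq_Rintegral => y _; rewrite mulrBl.
have -> : fourier_sin (fun y => h (vadd y s) - h (vadd y t)) l =
    fourier_sin (fun y => h (vadd y s)) l - fourier_sin (fun y => h (vadd y t)) l.
  rewrite -RintegralB//; try exact: integrable_fourier_sin.
  by apply: eq_Rintegral => y _; rewrite mulrBl.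
rewrite !fourier_cos_translate// !fourier_sin_translate// /phase_gap.
by ring.
Qed.

Lemma bessel_difference h s t : L.-integrable setT (EFin \o h) ->
  (\int[L]_l (power_spectrum h l * phase_gap l s t)%:E <=
   \int[L]_y ((h (vadd y s) - h (vadd y t)) ^+ 2)%:E)%E.
Proof.
move=> inth; have := bessel_inequality (RintegrableB (integrable_translate s inth)
  (integrable_translate t inth)).
by under eq_integral do rewrite power_spectrum_difference//.
Qed.

Lemma ge0_integral_dilate_difference h (r : R) u v : 0 < r -> measurable_fun setT h ->
  (\int[L]_x ((h (vscale r^-1 (vadd x u)) - h (vscale r^-1 (vadd x v))) ^+ 2)%:E =
   (r ^+ d)%:E * \int[L]_y ((h (vadd y (vscale r^-1 u)) - h (vadd y (vscale r^-1 v))) ^+ 2)%:E)%E.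
Proof.
move=> r0 mh; pose o : d.-tuple R := [tuple 0 | i < d].
rewrite (ge0_integral_affine_vec o r0); last 2 first.
- apply/measurable_EFinP; apply: measurable_funX; apply: measurable_funB;
    apply: (measurableT_comp mh); apply: measurable_vscale; exact: measurable_vadd.
- by move=> x; rewrite lee_fin sqr_ge0.
congr (_ * _)%E; apply: eq_integral => y _; congr (((h _ - h _) ^+ 2)%:E).
- by apply: eq_from_tnth => i; rewrite !tnth_mktuple; field; rewrite gt_eqF.
- by apply: eq_from_tnth => i; rewrite !tnth_mktuple; field; rewrite gt_eqF.
Qed.

End spectral.

Section unit_circle_variance.
Context d (T : measurableType d) (R : realType) (mu : probability T R).

Lemma integrable_le1 (p : T -> R) : measurable_fun setT p ->
  (forall x, `|p x| <= 1) -> mu.-integrable setT (EFin \o p).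
Proof.
move=> mp p1; apply: (le_Rintegrable (g := cst 1)) => //.
exact: finite_measure_integrable_cst.
Qed.

Lemma Rintegral_prob_cst (k : R) : \int[mu]_x k = k.
Proof.
rewrite Rintegral_cst// [X in fine X](_ : _ = 1%E) ?mulr1//.
exact: probability_setT.
Qed.

(** On the unit circle the squared distance of two points is 2 minus twice their inner product, and
    the mean inner product of two independent copies is the squared norm of the mean. *)
Lemma integral_unit_circle_gap (p q : T -> R) :
  measurable_fun setT p -> measurable_fun setT q ->
  (forall x, p x ^+ 2 + q x ^+ 2 = 1) ->
  (\int[mu]_u \int[mu]_v ((p u - p v) ^+ 2 + (q u - q v) ^+ 2)%:E =
   (2 - 2 * (\int[mu]_x p x) ^+ 2 - 2 * (\int[mu]_x q x) ^+ 2)%:E)%E.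
Proof.
move=> mp mq pq.
have p1 x : `|p x| <= 1.
  rewrite -(ler_pXn2r (n := 2)) ?nnegrE// expr1n real_normK ?num_real//.
  by rewrite -(pq x) lerDl sqr_ge0.
have q1 x : `|q x| <= 1.
  rewrite -(ler_pXn2r (n := 2)) ?nnegrE// expr1n real_normK ?num_real//.
  by rewrite -(pq x) lerDr sqr_ge0.
have ip := integrable_le1 mp p1; have iq := integrable_le1 mq q1.
(* Serves both integrations: over [v] with coefficients depending on [u], then over [u] with the
   means as coefficients. *)
have lin (a b c : R) :
    (\int[mu]_v (a - b * p v - c * q v)%:E =
    (a - b * (\int[mu]_x p x) - c * (\int[mu]_x q x))%:E)%E.
  have ia : mu.-integrable setT (EFin \o cst a) by exact: finite_measure_integrable_cst.
  have iab := RintegrableB ia (RintegrableZl b ip).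
  have icq := RintegrableZl c iq.
  rewrite -EFin_Rintegral; last exact: RintegrableB.
  rewrite RintegralB// RintegralB//; last exact: RintegrableZl.
  by rewrite !RintegralZl// Rintegral_prob_cst.
transitivity (\int[mu]_u (2 - (2 * \int[mu]_x p x) * p u - (2 * \int[mu]_x q x) * q u)%:E)%E.
  apply: eq_integral => u _.
  transitivity (\int[mu]_v (2 - (2 * p u) * p v - (2 * q u) * q v)%:E)%E.
    by apply: eq_integral => v _; congr EFin; have := pq u; have := pq v; lra.
  by rewrite lin; congr EFin; ring.
by rewrite lin; congr EFin; ring.
Qed.

End unit_circle_variance.

(** * Gaussian averages *)

Section density.
Context d (T : measurableType d) (R : realType).
Variables (nu : {finite_measure set T -> \bar R})
  (mu : {sigma_finite_measure set T -> \bar R}) (phi : T -> R).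
Hypothesis mphi : measurable_fun setT phi.
Hypothesis nuE : forall A, measurable A -> nu A = (\int[mu]_(x in A) (phi x)%:E)%E.

Lemma density_dominates : nu `<< mu.
Proof.
apply/null_content_dominatesP => A mA muA0; rewrite nuE//.
by apply: null_set_integral => //; apply/measurable_EFinP; exact: measurable_funTS.
Qed.

(** The Radon-Nikodym derivative of [nu] with respect to [mu] has the same integral as [phi] over
    every measurable set, hence equals it almost everywhere, and the change of variables for the
    derivative carries over. *)
Lemma ge0_integral_density (f : T -> \bar R) :
  measurable_fun setT f -> (forall x, (0 <= f x)%E) ->
  (\int[nu]_x f x = \int[mu]_x (f x * (phi x)%:E))%E.
Proof.
move=> mf f0; have numu := density_dominates.
rewrite -(Radon_Nikodym_SigmaFinite.change_of_variables numu)//.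
pose g := Radon_Nikodym_SigmaFinite.f nu mu.
have intg : mu.-integrable setT g := Radon_Nikodym_SigmaFinite.f_integrable numu.
have mg := measurable_int _ intg.
have gphi : ae_eq mu setT g (EFin \o phi).
  apply: integral_ae_eq => //; first exact/measurable_EFinP.
  by move=> A _ mA; rewrite -(Radon_Nikodym_SigmaFinite.f_integral numu)// nuE.
apply: ae_eq_integral => //.
- exact: emeasurable_funM.
- by apply: emeasurable_funM => //; exact/measurable_EFinP.
- by apply: filterS gphi => x H Dx /=; rewrite -/g (H Dx).
Qed.

End density.

Section gaussian_law.
Context d (R : realType) (mu : probability (d.-tuple R) R) (a : R).
Hypothesis a0 : 0 < a.
Hypothesis muE : forall A, measurable A ->
  mu A = (\int[@lebesgue_vec R d]_(x in A) (gauss_density a x)%:E)%E.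

Lemma Rintegral_gaussian_law_cos (l : d.-tuple R) (t : R) :
  \int[mu]_x cos (2 * pi * inner x l + t) =
  expR (- (pi ^+ 2 * a * inner l l)) * cos t.
Proof.
have mc : measurable_fun setT (fun x : d.-tuple R => cos (2 * pi * inner x l + t)).
  exact: measurable_cos_inner.
have ic : mu.-integrable setT (EFin \o (fun x : d.-tuple R => cos (2 * pi * inner x l + t))).
  by apply: integrable_le1 => // x; exact: cos_max.
have i1 : mu.-integrable setT (EFin \o (fun=> 1%R)) by exact: finite_measure_integrable_cst.
(* The density formula is available for nonnegative functions; adding 1 makes the cosine one, and
   the 1 cancels because both measures have total mass 1. *)
pose f (x : d.-tuple R) := (1 + cos (2 * pi * inner x l + t))%:E.
have mf : measurable_fun setT f.
  by apply/measurable_EFinP; exact: measurable_funD.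
have f0 x : (0 <= f x)%E.
  by rewrite lee_fin -lerBlDl sub0r; have := cos_geN1 (2 * pi * inner x l + t).
have := ge0_integral_density (@measurable_gauss_density R d a) muE mf f0.
rewrite -EFin_Rintegral; last exact: (RintegrableD i1 ic).
rewrite RintegralD// Rintegral_prob_cst.
have -> : (\int[@lebesgue_vec R d]_x (f x * (gauss_density a x)%:E) =
   1 + (expR (- (pi ^+ 2 * a * inner l l)) * cos t)%:E)%E.
  rewrite -(integral_gauss_density d a0) -integral_gauss_density_cos// -integralD//.
  - by apply: eq_integral => x _; rewrite -EFinM -EFinD; congr EFin; ring.
  - exact: integrable_gauss_density.
  - exact: integrable_gauss_density_cos.
by rewrite -EFinD => -[] /addrI.
Qed.

(** The dilation moves from [u] to [l]. The mean of the sine vanishes, being a cosine mean with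
    phase [- pi / 2], so only the squared cosine mean remains; squaring doubles the exponent to the
    rate [2 * pi ^ 2 * a]. *)
Lemma integral_gaussian_law_phase_gap (r : R) (l : d.-tuple R) :
  (\int[mu]_u \int[mu]_v
     (phase_gap l (vscale r^-1 u) (vscale r^-1 v))%:E =
   (2 - 2 * expR (- (2 * pi ^+ 2 * a * (inner l l / r ^+ 2))))%:E)%E.
Proof.
pose l' := vscale r^-1 l.
have E u : inner (vscale r^-1 u) l = inner u l'.
  by rewrite inner_scalel [RHS]innerC inner_scalel innerC.
rewrite /phase_gap.
under eq_integral do under eq_integral do rewrite !E.
rewrite integral_unit_circle_gap; last 3 first.
- exact: measurable_cos_inner2.
- exact: measurable_sin_inner.
- by move=> x; exact: cos2Dsin2.
have -> : \int[mu]_x cos (2 * pi * inner x l') = expR (- (pi ^+ 2 * a * inner l' l')).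
  transitivity (\int[mu]_x cos (2 * pi * inner x l' + 0)).
    by apply: eq_Rintegral => x _; rewrite addr0.
  by rewrite Rintegral_gaussian_law_cos cos0 mulr1.
have -> : \int[mu]_x sin (2 * pi * inner x l') = 0.
  transitivity (\int[mu]_x cos (2 * pi * inner x l' + - (pi / 2))).
    by apply: eq_Rintegral => x _; rewrite cosD sinN cosN cos_pihalf sin_pihalf; ring.
  by rewrite Rintegral_gaussian_law_cos cosN cos_pihalf mulr0.
rewrite expr0n/= mulr0 subr0 expr2 -expRD; congr (2 - 2 * expR _)%:E.
by rewrite /l' inner_scalel innerC inner_scalel -exprVn; ring.
Qed.

End gaussian_law.

(** * Countable sums and the tiling by unit cubes *)

Section countable_sums.
Context {R : realType} {I : countType}.

(** Sums over a countable type become series over the naturals; an index that encodes no element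
    gets the default [v0], always 0 below, so it adds nothing. *)
Definition enum_val0 (V : Type) (v0 : V) (f : I -> V) (k : nat) : V :=
  oapp f v0 (pickle_inv k).

Lemma enum_val0_pickle (V : Type) (v0 : V) (f : I -> V) (i : I) :
  enum_val0 v0 f (choice.pickle i) = f i.
Proof. by rewrite /enum_val0 pickleK_inv. Qed.

Lemma esum_enum (f : I -> \bar R) : (forall i, (0 <= f i)%E) ->
  (\esum_(i in [set: I]) f i = \sum_(0 <= k <oo) enum_val0 0 f k)%E.
Proof.
move=> f0; rewrite nneseries_esumT; last first.
  by move=> k; rewrite /enum_val0; case: pickle_inv => //=.
transitivity (\esum_(k in range (@choice.pickle I)) enum_val0 0%E f k).
  rewrite (reindex_esum [set: I] (range choice.pickle) choice.pickle).
    by apply: eq_esum => i _; rewrite enum_val0_pickle.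
  split; [by move=> i _; exists i|by move=> i j _ _; exact: (pcan_inj pickleK_inv)|].
  by move=> _ [i _ <-]; exists i.
rewrite esum_mkcond; apply: eq_esum => k _.
case: ifPn => // /negP kr; rewrite /enum_val0.
case E : (pickle_inv k) => [i|//]; exfalso; apply: kr; rewrite inE; exists i => //.
by have := @pickle_invK I k; rewrite E.
Qed.

Lemma ge0_integral_esum d (T : measurableType d) (mu : {measure set T -> \bar R})
    (f : I -> T -> \bar R) :
  (forall i, measurable_fun setT (f i)) -> (forall i x, (0 <= f i x)%E) ->
  (\int[mu]_x (\esum_(i in [set: I]) f i x) = \esum_(i in [set: I]) \int[mu]_x f i x)%E.
Proof.
move=> mf f0; rewrite esum_enum; last by move=> i; exact: integral_ge0.
under eq_integral do rewrite esum_enum//.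
rewrite integral_nneseries//; last 2 first.
- move=> k; rewrite /enum_val0; case: pickle_inv => [i|]//=.
- by move=> k x _; rewrite /enum_val0; case: pickle_inv => [i|]//=.
apply: eq_eseriesr => k _; rewrite /enum_val0; case: pickle_inv => [i|]//=.
by rewrite integral0.
Qed.

Lemma measurable_esum d (T : measurableType d) (f : I -> T -> \bar R) :
  (forall i, measurable_fun setT (f i)) -> (forall i x, (0 <= f i x)%E) ->
  measurable_fun setT (fun x => \esum_(i in [set: I]) f i x).
Proof.
move=> mf f0; under eq_fun do rewrite esum_enum//.
apply: ge0_emeasurable_sum => k.
  by move=> x _; rewrite /enum_val0; case: pickle_inv => [i|]//=.
by move=> _; rewrite /enum_val0; case: pickle_inv => [i|]//=.
Qed.

End countable_sums.

Section tiling.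
Context {R : realType} (d : nat).
Local Notation L := (@lebesgue_vec R d).

(** Integer translates of this cube partition the space, while those of the closed [unit_cube] of
    the model share faces. *)
Definition half_open_cube : set (d.-tuple R) := [set x | forall i, 0 <= tnth x i < 1].

Lemma measurable_box (A : 'I_d -> set R) : (forall i, measurable (A i)) ->
  measurable [set x : d.-tuple R | forall i, A i (tnth x i)].
Proof.
move=> mA; have -> : [set x : d.-tuple R | forall i, A i (tnth x i)] =
    \bigcap_(i in [set: 'I_d]) ((fun x : d.-tuple R => tnth x i) @^-1` A i).
  by apply/seteqP; split=> [x Bx i _|x Bx i]; [exact: Bx|exact: Bx i I].
apply: fin_bigcap_measurable => [|i _]; first exact: finite_finset.
by rewrite -[X in measurable X]setTI; exact: measurable_tnth.
Qed.

Lemma half_open_cubeE : half_open_cube = [set x | forall i, `[0%R, 1%R[%classic (tnth x i)].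
Proof. by apply/seteqP; split => x hx i; have := hx i; rewrite /= in_itv. Qed.

Lemma unit_cubeE : @unit_cube R d = [set x | forall i, `[0%R, 1%R]%classic (tnth x i)].
Proof. by apply/seteqP; split => x hx i; have := hx i; rewrite /= in_itv. Qed.

Lemma measurable_half_open_cube : measurable half_open_cube.
Proof. by rewrite half_open_cubeE; apply: (measurable_box (A := fun=> `[0%R, 1%R[%classic)) => i; exact: measurable_itv. Qed.

Lemma measurable_unit_cube : measurable (@unit_cube R d).
Proof. by rewrite unit_cubeE; apply: (measurable_box (A := fun=> `[0%R, 1%R]%classic)) => i; exact: measurable_itv. Qed.

Lemma lebesgue_half_open_cube : L half_open_cube = 1%E.
Proof.
rewrite half_open_cubeE (lebesgue_vec_box (A := fun=> `[0%R, 1%R[%classic)).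
  by apply: big1 => i _; rewrite lebesgue_measure_itv/= lte_fin ltr01 oppr0 adde0.
by move=> i; exact: measurable_itv.
Qed.

Lemma lebesgue_unit_cube : L (@unit_cube R d) = 1%E.
Proof.
rewrite unit_cubeE (lebesgue_vec_box (A := fun=> `[0%R, 1%R]%classic)).
  by apply: big1 => i _; rewrite lebesgue_measure_itv/= lte_fin ltr01 oppr0 adde0.
by move=> i; exact: measurable_itv.
Qed.

(** The two cubes are nested and both have volume 1, so the faces by which they differ form a null
    set. *)
Lemma lebesgue_cubeI (A : set (d.-tuple R)) : measurable A ->
  L (A `&` @unit_cube R d) = L (A `&` half_open_cube).
Proof.
move=> mA; have mU := measurable_unit_cube; have mH := measurable_half_open_cube.
have HU : half_open_cube `<=` @unit_cube R d.
  by move=> x hx i; have /andP[-> /ltW] := hx i.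
have D0 : L (@unit_cube R d `\` half_open_cube) = 0%E.
  rewrite measureD//; last by rewrite [X in (X < _)%E]lebesgue_unit_cube ltry.
  rewrite (setIidr HU).
  by rewrite [X in (X - _)%E]lebesgue_unit_cube [X in (_ - X)%E]lebesgue_half_open_cube subee.
apply/eqP; rewrite eq_le; apply/andP; split; last first.
  by apply: le_measure; rewrite ?inE; [exact: measurableI|exact: measurableI|exact: setIS].
have -> : A `&` @unit_cube R d = (A `&` half_open_cube) `|` (A `&` (@unit_cube R d `\` half_open_cube)).
  by rewrite -setIUr setDUK.
apply: (le_trans (measureU2 _ _ _)).
- exact: measurableI.
- by apply: measurableI => //; exact: measurableD.
rewrite -[leRHS]adde0 leeD2l// -D0; apply: le_measure; rewrite ?inE.
- by apply: measurableI => //; exact: measurableD.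
- exact: measurableD.
- by move=> x [].
Qed.

Lemma half_open_cube_floor (x : d.-tuple R) (n : d.-tuple int) :
  half_open_cube (vsub x (@vint R d n)) <-> n = [tuple Num.floor (tnth x i) | i < d].
Proof.
split=> [hx|-> i].
  apply: eq_from_tnth => i; rewrite tnth_mktuple; apply/esym/floor_def.
  have := hx i; rewrite !tnth_mktuple mulN1r subr_ge0 => /andP[-> ].
  by rewrite intrD ltrBlDr addrC.
rewrite !tnth_mktuple mulN1r subr_ge0 ltrBlDr addrC.
have := floor_itv (tnth x i); by rewrite intrD.
Qed.

(** After translating each term and exchanging sum and integral, exactly one term survives at each
    [x]: the one whose index is the vector of integer parts of [x]. *)
Lemma ge0_integral_tiling (f : d.-tuple R -> \bar R) :
  measurable_fun setT f -> (forall x, (0 <= f x)%E) ->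
  (\esum_(n in [set: d.-tuple int])
     \int[L]_z (f (vadd (@vint R d n) z) * (\1_half_open_cube z)%:E) =
   \int[L]_x f x)%E.
Proof.
move=> mf f0; have mH := measurable_half_open_cube.
pose F (n : d.-tuple int) x := (f x * (\1_half_open_cube (vsub x (@vint R d n)))%:E)%E.
have mF n : measurable_fun setT (F n).
  apply: emeasurable_funM => //; apply/measurable_EFinP.
  by apply: (measurableT_comp (measurable_indic mH)); exact: measurable_vsub.
have F0 n x : (0 <= F n x)%E by rewrite mule_ge0// lee_fin.
transitivity (\esum_(n in [set: d.-tuple int]) \int[L]_x F n x)%E.
  apply: eq_esum => n _; rewrite -(ge0_integral_translate (@vint R d n) (mF n) (F0 n)).
  apply: eq_integral => z _; rewrite /F; congr (f _ * (\1_half_open_cube _)%:E)%E.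
    by apply: eq_from_tnth => i; rewrite !tnth_mktuple addrC.
  by apply: eq_from_tnth => i; rewrite !tnth_mktuple; ring.
rewrite -ge0_integral_esum//; apply: eq_integral => x _.
pose n0 := [tuple Num.floor (tnth x i) | i < d].
rewrite -[RHS](esum_set1 (t := n0) (a := fun=> f x))// [RHS]esum_mkcond.
apply: eq_esum => n _; rewrite /F; case: ifPn => [|/negP].
  rewrite inE /= => ->; rewrite indicE mem_set ?mule1//.
  exact/half_open_cube_floor.
move=> nn0; rewrite indicE memNset ?mule0// => /half_open_cube_floor nE.
by apply: nn0; rewrite inE.
Qed.

End tiling.

(** * Variance of a series of conditionally independent terms *)

Section variance_bound.
Context disp (Omega : measurableType disp) (R : realType) (P : probability Omega R).

Lemma integrable_mul_sq (f g : Omega -> R) :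
  measurable_fun setT f -> measurable_fun setT g ->
  P.-integrable setT (EFin \o (fun w => f w ^+ 2)) ->
  P.-integrable setT (EFin \o (fun w => g w ^+ 2)) ->
  P.-integrable setT (EFin \o (fun w => f w * g w)).
Proof.
move=> mf mg if2 ig2; apply: (le_Rintegrable _ _ (RintegrableD if2 ig2)).
  exact: measurable_funM.
move=> w; rewrite normrM -(real_normK (num_real (f w))) -(real_normK (num_real (g w))).
have := sqr_ge0 (`|f w| - `|g w|); have := sqr_ge0 (`|f w|); have := sqr_ge0 (`|g w|); nra.
Qed.

Lemma Rintegrable_sum (J : Type) (s : seq J) (f : J -> Omega -> R) :
  (forall j, P.-integrable setT (EFin \o f j)) ->
  P.-integrable setT (EFin \o (fun w => \sum_(j <- s) f j w)).
Proof.
move=> intf; elim: s => [|j s IH].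
  by under [X in EFin \o X]eq_fun do rewrite big_nil; exact: finite_measure_integrable_cst.
by under [X in EFin \o X]eq_fun do rewrite big_cons; exact: RintegrableD.
Qed.

Lemma Rintegral_sum (J : Type) (s : seq J) (f : J -> Omega -> R) :
  (forall j, P.-integrable setT (EFin \o f j)) ->
  \int[P]_w (\sum_(j <- s) f j w) = \sum_(j <- s) \int[P]_w f j w.
Proof.
move=> intf; elim: s => [|j s IH].
  by under eq_Rintegral do rewrite big_nil; rewrite big_nil Rintegral_prob_cst.
under eq_Rintegral do rewrite big_cons; rewrite big_cons RintegralD// ?IH//.
exact: Rintegrable_sum.
Qed.

Lemma varianceE_integral (X : Omega -> R) :
  'V_P[X] = (\int[P]_w ((X w - fine 'E_P[X]) ^+ 2)%:E)%E.
Proof. by rewrite /variance unlock unlock; apply: eq_integral => w _; rewrite expr2. Qed.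

(* Integrate [(X - E X - Y) ^ 2 >= 0] for [Y = \sum_(n <- s) Y n]. *)
Lemma variance_ge_sum_orthogonal (I : eqType) (X : Omega -> R) (Y : I -> Omega -> R) (s : seq I) :
  measurable_fun setT X -> (forall n, measurable_fun setT (Y n)) ->
  (forall n, P.-integrable setT (EFin \o (fun w => Y n w ^+ 2))) ->
  (forall n, \int[P]_w Y n w = 0) ->
  (forall n m, n != m -> \int[P]_w (Y n w * Y m w) = 0) ->
  (forall n, P.-integrable setT (EFin \o (fun w => X w * Y n w))) ->
  (forall n, \int[P]_w (X w * Y n w) = \int[P]_w (Y n w ^+ 2)) ->
  uniq s ->
  ((\sum_(n <- s) \int[P]_w (Y n w ^+ 2))%:E <= 'V_P[X])%E.
Proof.
move=> mX mY iY2 EY EYY iXY EXY us; rewrite varianceE_integral.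
set e := fine _; pose D w := X w - e; pose Z w := \sum_(n <- s) Y n w.
have iY n : P.-integrable setT (EFin \o Y n).
  have i1 : P.-integrable setT (EFin \o (fun=> 1 ^+ 2 : R)) by exact: finite_measure_integrable_cst.
  have := integrable_mul_sq (mY n) (measurable_cst (1 : R)) (iY2 n) i1.
  by apply: eq_integrable => // w _; rewrite /= mulr1.
have iYY n m : P.-integrable setT (EFin \o (fun w => Y n w * Y m w)) by exact: integrable_mul_sq.
(* This is [(X - e)^2 - (X - e - Z)^2] expanded, so that the square of [X] drops out and every
   remaining term is integrable by hypothesis. *)
pose W w := 2 * (\sum_(n <- s) X w * Y n w) - 2 * e * (\sum_(n <- s) Y n w) - \sum_(n <- s) \sum_(m <- s) Y n w * Y m w.
have i1 := RintegrableZl 2 (Rintegrable_sum s iXY).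
have i2 := RintegrableZl (2 * e) (Rintegrable_sum s iY).
have i3 := Rintegrable_sum s (fun n => Rintegrable_sum s (iYY n)).
have i12 := RintegrableB i1 i2.
have iW : P.-integrable setT (EFin \o W) by exact: RintegrableB.
have EW : \int[P]_w W w = \sum_(n <- s) \int[P]_w (Y n w ^+ 2).
  rewrite RintegralB// RintegralB// !RintegralZl//; try exact: Rintegrable_sum.
  rewrite !Rintegral_sum//; last by move=> n; exact: Rintegrable_sum.
  rewrite [X in _ - _ * X]big1 => [|n _]; last exact: EY.
  rewrite mulr0 subr0.
  (* The cross term gives twice the sum of the squares; orthogonality makes the double sum subtract
     it once. *)
  rewrite (eq_bigr _ (fun n _ => EXY n)).
  rewrite [X in _ - X](_ : _ = \sum_(n <- s) \int[P]_w (Y n w ^+ 2)).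
    by rewrite mulr2n mulrDl mul1r addrK.
  apply: eq_big_seq => n ns; rewrite Rintegral_sum// (bigD1_seq n)//=.
  rewrite big1 ?addr0//.
  by move=> m mn; apply: EYY; rewrite eq_sym.
rewrite -EW EFin_Rintegral//.
have mW := Rintegrable_measurable iW.
(* [W] is signed and integrable, whereas [(X - e)^2] is nonnegative and possibly of infinite
   integral; the positive part of [W] mediates between the two monotonicity statements. *)
have mW0 : measurable_fun setT (fun w => Num.max (W w) 0) by exact: measurable_maxr.
have iW0 : P.-integrable setT (EFin \o (fun w => Num.max (W w) 0)).
  apply: (le_Rintegrable mW0 _ (Rintegrable_norm iW)) => w.
  by rewrite ger0_norm ?le_max ?lexx ?orbT// ge_max ler_norm normr_ge0.
apply: (@le_trans _ _ (\int[P]_w (Num.max (W w) 0)%:E)%E).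
  by apply: le_integral => // w _; rewrite lee_fin le_max lexx.
apply: ge0_le_integral => //.
- by move=> w _; rewrite lee_fin le_max lexx orbT.
- exact/measurable_EFinP.
- by apply/measurable_EFinP; apply: measurable_funX; exact: measurable_funB.
- move=> w _; rewrite lee_fin ge_max sqr_ge0 andbT.
  have -> : W w = 2 * X w * Z w - 2 * e * Z w - Z w ^+ 2.
    rewrite /W /Z expr2 mulr_suml -!mulr_sumr; congr (_ - _); first by rewrite mulrA.
    by apply: eq_bigr => n _; rewrite mulr_sumr.
  have := sqr_ge0 (X w - e - Z w); nra.
Qed.

End variance_bound.

(** * Limits of unordered sums, transfer to laws, and mean squared gaps *)

Section unordered_sums.
Context {R : realType} {I : countType}.

Lemma cvg_enum_sum (a : I -> R) : (forall i, 0 <= a i) ->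
  (\esum_(i in [set: I]) (a i)%:E < +oo)%E ->
  (\sum_(0 <= k < n) enum_val0 0 a k)%R @[n --> \oo] --> fine (\esum_(i in [set: I]) (a i)%:E).
Proof.
move=> a0 ay; pose b k := enum_val0 0%E (EFin \o a) k.
have b0 k : (0 <= b k)%E by rewrite /b /enum_val0; case: pickle_inv => [i|]; rewrite /= ?lee_fin.
have E : (\esum_(i in [set: I]) (a i)%:E = \sum_(0 <= k <oo) b k)%E by rewrite esum_enum.
have fE : (\sum_(0 <= k <oo) b k)%E \is a fin_num.
  by rewrite -E ge0_fin_numE//; apply: esum_ge0 => i _; rewrite lee_fin.
have cb : (\sum_(0 <= k < n) b k)%E @[n --> \oo] --> (fine (\sum_(0 <= k <oo) b k)%E)%:E.
  rewrite fineK//; apply: is_cvg_nneseries => //.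
rewrite E; apply: cvg_trans (fine_cvg cb).
apply: near_eq_cvg; apply: nearW => n /=.
rewrite (eq_bigr (fun k => (enum_val0 0 a k)%:E)); first by rewrite sumEFin.
by move=> k _; rewrite /b /enum_val0; case: pickle_inv.
Qed.

(** Absolute summability makes the positive and negative parts converge separately. This presents
    the sum as a limit of partial sums, the form that dominated convergence requires. *)
Lemma cvg_unordered_sum (f : I -> R) : (\esum_(i in [set: I]) `|f i|%:E < +oo)%E ->
  (\sum_(0 <= k < n) enum_val0 0 f k)%R @[n --> \oo] --> unordered_sum f.
Proof.
move=> fy; rewrite /unordered_sum.
have py : (\esum_(i in [set: I]) (f^\+ i)%:E < +oo)%E.
  by apply: le_lt_trans fy; apply: le_esum => i _; rewrite lee_fin ge_max ler_norm normr_ge0.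
have ny : (\esum_(i in [set: I]) (f^\- i)%:E < +oo)%E.
  by apply: le_lt_trans fy; apply: le_esum => i _; rewrite lee_fin ge_max -normrN ler_norm normr_ge0.
have p0 i : 0 <= f^\+ i by rewrite le_max lexx orbT.
have n0 i : 0 <= f^\- i by rewrite le_max lexx orbT.
apply: cvg_trans (cvgB (cvg_enum_sum p0 py) (cvg_enum_sum n0 ny)).
apply: near_eq_cvg; apply: nearW => n /=.
transitivity ((\sum_(0 <= k < n) enum_val0 0 f^\+ k) - \sum_(0 <= k < n) enum_val0 0 f^\- k) => //.
rewrite -sumrB; apply: eq_bigr => k _; rewrite /enum_val0.
case: pickle_inv => [i|]/=; last by rewrite subrr.
exact: (congr1 (fun g : I -> R => g i) (funrposBneg f)).
Qed.

Lemma enum_sum_le (a : I -> R) (n : nat) : (forall i, 0 <= a i) ->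
  ((\sum_(0 <= k < n) enum_val0 0%R a k)%:E <= \esum_(i in [set: I]) (a i)%:E)%E.
Proof.
move=> a0; rewrite esum_enum; last by move=> i; rewrite lee_fin.
apply: le_trans (nneseries_lim_ge n _); last first.
  by move=> k _ _; rewrite /enum_val0; case: pickle_inv => [i|]/=; rewrite ?lee_fin.
rewrite -sumEFin; apply: lee_sum => k _.
by rewrite /enum_val0; case: pickle_inv => [i|].
Qed.

Lemma measurable_unordered_sum d (T : measurableType d) (f : I -> T -> R) :
  (forall i, measurable_fun setT (f i)) ->
  measurable_fun setT (fun x => unordered_sum (fun i => f i x)).
Proof.
move=> mf; apply: measurable_funB; apply: (measurableT_comp (fine_measurable measurableT)).
- apply: (measurable_esum (f := fun i x => ((f i)^\+ x)%:E)).
    by move=> i; apply/measurable_EFinP; exact: measurable_funrpos.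
  by move=> i x; rewrite lee_fin funrpos_ge0.
- apply: (measurable_esum (f := fun i x => ((f i)^\- x)%:E)).
    by move=> i; apply/measurable_EFinP; exact: measurable_funrneg.
  by move=> i x; rewrite lee_fin funrneg_ge0.
Qed.

End unordered_sums.

Lemma lt_esumZl (R : realType) (I : countType) (c : R) (a : I -> \bar R) : 0 <= c ->
  (forall i, (0 <= a i)%E) -> (\esum_(i in [set: I]) a i < +oo)%E ->
  (\esum_(i in [set: I]) (c%:E * a i) < +oo)%E.
Proof.
move=> c0 a0; rewrite !esum_enum//; last by move=> i; rewrite mule_ge0.
rewrite (_ : (\sum_(0 <= k <oo) enum_val0 0 (fun i => c%:E * a i) k =
    c%:E * \sum_(0 <= k <oo) enum_val0 0 a k)%E).
  move=> ay; apply: lte_mul_pinfty => //.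
rewrite -nneseriesZl; last first.
  by move=> k _; rewrite /enum_val0; case: pickle_inv => /=.
apply: eq_eseriesr => k _; rewrite /enum_val0; case: pickle_inv => //=.
by rewrite mule0.
Qed.

Section image_law.
Context d1 d2 (Omega : measurableType d1) (V : measurableType d2) (R : realType).
Variables (P : {measure set Omega -> \bar R}) (lam : {measure set V -> \bar R}) (Phi : Omega -> V).
Hypothesis mPhi : measurable_fun setT Phi.
Hypothesis law : forall A, measurable A -> P (Phi @^-1` A) = lam A.

Lemma ge0_integral_law (F : V -> \bar R) : measurable_fun setT F -> (forall v, (0 <= F v)%E) ->
  (\int[P]_w F (Phi w) = \int[lam]_v F v)%E.
Proof.
move=> mF F0; transitivity (\int[image_measure P mPhi]_v F v)%E.
  by rewrite [RHS]ge0_integral_pushforward.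
by apply: eq_measure_integral => A mA _; exact: law.
Qed.

Lemma integrable_law (F : V -> R) : measurable_fun setT F ->
  P.-integrable setT (EFin \o (fun w => F (Phi w))) <-> lam.-integrable setT (EFin \o F).
Proof.
move=> mF; have E : (\int[P]_w `|(F (Phi w))%:E| = \int[lam]_v `|(F v)%:E|)%E.
  rewrite (ge0_integral_law (F := fun v => `|(F v)%:E|%E))//.
  by apply: measurableT_comp => //; exact/measurable_EFinP.
split=> /integrableP[_ fy]; apply/integrableP; split; rewrite ?E// -?E//.
  exact/measurable_EFinP.
by apply/measurable_EFinP; exact: measurableT_comp.
Qed.

Lemma Rintegral_law (F : V -> R) : measurable_fun setT F ->
  lam.-integrable setT (EFin \o F) ->
  \int[P]_w F (Phi w) = \int[lam]_v F v.
Proof.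
move=> mF iF; rewrite /Rintegral; congr fine.
transitivity (\int[image_measure P mPhi]_v (F v)%:E)%E; last first.
  by apply: eq_measure_integral => A mA _; exact: law.
rewrite [RHS]integral_pushforward//; first exact/measurable_EFinP.
exact/integrable_law.
Qed.

End image_law.

Section half_gap.
Context d (T : measurableType d) (R : realType) (mu : probability T R).

Lemma Rintegral_center (p : T -> R) : mu.-integrable setT (EFin \o p) ->
  \int[mu]_u (p u - \int[mu]_x p x) = 0.
Proof.
move=> ip; rewrite RintegralB//; last exact: finite_measure_integrable_cst.
by rewrite Rintegral_prob_cst subrr.
Qed.

Lemma integrable_center (p : T -> R) (c : R) : mu.-integrable setT (EFin \o p) ->
  mu.-integrable setT (EFin \o (fun u => p u - c)).
Proof.
by move=> ip; apply: RintegrableB => //; exact: finite_measure_integrable_cst.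
Qed.

(** Half the mean squared difference of two independent copies is the variance. With [A] the centred
    function, the cross term [A u * A v] integrates to 0 and the two halves add up; if the variance
    is infinite the inequality is trivial. *)
Lemma half_gap_le (p : T -> R) : mu.-integrable setT (EFin \o p) ->
  (\int[mu]_u \int[mu]_v ((2^-1 * (p u - p v) ^+ 2)%:E) <=
   \int[mu]_u ((p u - \int[mu]_x p x) ^+ 2)%:E)%E.
Proof.
move=> ip; have mp := Rintegrable_measurable ip.
set m := \int[mu]_x p x; pose A u := p u - m.
have iA : mu.-integrable setT (EFin \o A) by exact: integrable_center.
have mA := Rintegrable_measurable iA.
have A0 : \int[mu]_u A u = 0 by exact: Rintegral_center.
have [Ay|Ay] := eqVneq (\int[mu]_u (A u ^+ 2)%:E)%E +oo%E; first by rewrite [leRHS]Ay leey.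
have iA2 : mu.-integrable setT (EFin \o (fun u => A u ^+ 2)).
  apply/integrableP; split; first by apply/measurable_EFinP; exact: measurable_funX.
  by under eq_integral do rewrite /= ger0_norm ?sqr_ge0//; rewrite ltey.
have halfE u : (\int[mu]_v (2^-1 * (p u - p v) ^+ 2)%:E =
    (2^-1 * A u ^+ 2 + 2^-1 * \int[mu]_v (A v ^+ 2))%:E)%E.
  transitivity (\int[mu]_v (2^-1 * A u ^+ 2 - A u * A v + 2^-1 * A v ^+ 2)%:E)%E.
    by apply: eq_integral => v _; congr EFin; rewrite /A; field.
  have ic : mu.-integrable setT (EFin \o (fun=> 2^-1 * A u ^+ 2)) by exact: finite_measure_integrable_cst.
  have i1 := RintegrableB ic (RintegrableZl (A u) iA).
  have i2 := RintegrableZl 2^-1 iA2.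
  rewrite -EFin_Rintegral; last exact: RintegrableD.
  rewrite RintegralD// RintegralB//; last exact: RintegrableZl.
  by rewrite Rintegral_prob_cst !RintegralZl// A0 mulr0 subr0.
under eq_integral do rewrite halfE.
have ic : mu.-integrable setT (EFin \o (fun=> 2^-1 * \int[mu]_v (A v ^+ 2))) by exact: finite_measure_integrable_cst.
have i2 := RintegrableZl 2^-1 iA2.
rewrite -EFin_Rintegral; last exact: RintegrableD.
rewrite RintegralD// RintegralZl// Rintegral_prob_cst -EFin_Rintegral// lee_fin.
by rewrite -mulrDl (_ : 2^-1 + 2^-1 = 1 :> R) ?mul1r//; field.
Qed.

End half_gap.

Lemma Rintegral_prod_eq0 d1 d2 (T1 : measurableType d1) (T2 : measurableType d2)
    (R : realType) (m1 : {sigma_finite_measure set T1 -> \bar R})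
    (m2 : {sigma_finite_measure set T2 -> \bar R}) (F : T1 * T2 -> R) :
  (m1 \x m2)%E.-integrable setT (EFin \o F) ->
  (forall x, \int[m2]_y (F (x, y))%:E = 0)%E ->
  \int[(m1 \x m2)%E]_z F z = 0.
Proof.
move=> iF F0; rewrite /Rintegral -(integral12_prod_meas1 (m1 := m1) (m2 := m2) iF).
by rewrite (eq_integral (cst 0%E)) ?integral0// => x _; exact: F0.
Qed.

(** * Truncated conditional fluctuations of the series *)

Section conditionally_independent_series.
Context {R : realType} {I : countType} {d0 d1 d2 : measure_display}
  {Omega : measurableType d0} {S : measurableType d1} {T : measurableType d2}.
Variables (P : probability Omega R) (nu : probability S R) (mu : probability T R).
Variables (zeta : Omega -> S) (xi : I -> Omega -> T) (g : I -> S * T -> R).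
Hypothesis mzeta : measurable_fun setT zeta.
Hypothesis mxi : forall n, measurable_fun setT (xi n).
Hypothesis mg : forall n, measurable_fun setT (g n).
(** Second moments involve at most two of the [xi n] at once, so independence is recorded through
    the joint laws of [zeta] with one and with two of them. *)
Hypothesis law1 : forall n A, measurable A ->
  P ((fun w => (zeta w, xi n w)) @^-1` A) = (nu \x mu)%E A.
Hypothesis law2 : forall n m A, n != m -> measurable A ->
  P ((fun w => (zeta w, (xi n w, xi m w))) @^-1` A) = (nu \x prod_measure mu mu)%E A.
Hypothesis g_summable :
  (\esum_(n in [set: I]) \int[nu]_z \int[mu]_u `|g n (z, u)|%:E < +oo)%E.
Hypothesis g_square : forall n, (\int[nu]_z \int[mu]_u (g n (z, u) ^+ 2)%:E < +oo)%E.

Let X w := unordered_sum (fun n => g n (zeta w, xi n w)).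

Let mpair1 n : measurable_fun setT (fun w => (zeta w, xi n w)).
Proof. exact: measurable_fun_pair. Qed.

Let mpair2 n m : measurable_fun setT (fun w => (zeta w, (xi n w, xi m w))).
Proof. by apply: measurable_fun_pair => //; exact: measurable_fun_pair. Qed.

Let mgz n z : measurable_fun setT (fun u => g n (z, u)).
Proof. exact: measurableT_comp. Qed.

Let mX1 n : measurable_fun setT (fun w => g n (zeta w, xi n w)).
Proof. exact: (measurableT_comp (mg n) (mpair1 n)). Qed.

Let mX : measurable_fun setT X.
Proof. exact: measurable_unordered_sum. Qed.

Let absg n z := (\int[mu]_u `|g n (z, u)|%:E)%E.

Let absg_ge0 n z : (0 <= absg n z)%E.
Proof. by apply: integral_ge0 => u _; rewrite lee_fin. Qed.

Let mabsg n : measurable_fun setT (absg n).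
Proof.
apply: (measurable_integral_snd mu (G := fun x => `|g n x|%:E)).
  by apply/measurable_EFinP; exact: measurableT_comp.
by move=> x; rewrite lee_fin.
Qed.

(** The conditional expectation of the sum of the [|X_n|] given [zeta = z]. Its integral is finite,
    hence it is finite for almost every [z]. *)
Let Sg z := \esum_(n in [set: I]) absg n z.

Let Sg_ge0 z : (0 <= Sg z)%E. Proof. by apply: esum_ge0. Qed.

Let mSg : measurable_fun setT Sg. Proof. exact: measurable_esum. Qed.

Let integral_Sg : (\int[nu]_z Sg z < +oo)%E.
Proof. by rewrite ge0_integral_esum. Qed.

Let absg_le_Sg n z : (absg n z <= Sg z)%E.
Proof.
rewrite -[leLHS](esum_set1 (t := n) (a := fun n => absg n z))//.
by rewrite [leLHS]esum_mkcond; apply: le_esum => i _; case: ifP.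
Qed.

Let mean n z := \int[mu]_u g n (z, u).

Let mmean n : measurable_fun setT (mean n).
Proof. exact: measurable_Rintegral_snd. Qed.

(** The conditional variance of the [n]-th term given [zeta = z], written without the conditional
    mean. *)
Let gap n z := (\int[mu]_u \int[mu]_v (2^-1 * (g n (z, u) - g n (z, v)) ^+ 2)%:E)%E.

Let gap_ge0 n z : (0 <= gap n z)%E.
Proof.
by apply: integral_ge0 => u _; apply: integral_ge0 => v _; rewrite lee_fin mulr_ge0// sqr_ge0.
Qed.

Let mgap n : measurable_fun setT (gap n).
Proof.
pose F (x : S * T * T) := (2^-1 * (g n x.1 - g n (x.1.1, x.2)) ^+ 2)%:E.
have F0 x : (0 <= F x)%E by rewrite lee_fin mulr_ge0// sqr_ge0.
have mF : measurable_fun setT F.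
  apply/measurable_EFinP; apply: measurable_funM => //; apply: measurable_funX.
  apply: measurable_funB; first by apply: measurableT_comp => //; exact: measurable_fst.
  apply: (measurableT_comp (mg n)); apply: measurable_fun_pair => //.
  by apply: measurableT_comp => //; exact: measurable_fst.
have m1 := measurable_integral_snd mu mF F0.
apply: (measurable_integral_snd mu m1) => x.
by apply: integral_ge0 => v _; exact: F0.
Qed.

Section truncation.
Variable K : nat.

(* On [B] the conditional expectations of the [`|X m|] have a bounded sum: this
   dominates the cross terms [X m * Y n], although [X] need not be square integrable. *)
Let B : set S := [set z | (Sg z <= K%:R%:E)%E].

Let mB : measurable B.
Proof.
rewrite (_ : B = Sg @^-1` `]-oo, K%:R%:E]%classic); last first.
  by apply/seteqP; split => z /=; rewrite in_itv.
by rewrite -[X in measurable X]setTI; apply: mSg => //; exact: emeasurable_itv.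
Qed.

Let integrable_gB n z : B z -> mu.-integrable setT (EFin \o (fun u => g n (z, u))).
Proof.
move=> Bz; apply/integrableP; split; first exact/measurable_EFinP.
exact: le_lt_trans (absg_le_Sg n z) (le_lt_trans Bz (ltry _)).
Qed.

Let mean_le n z : B z -> `|mean n z| <= K%:R.
Proof.
move=> Bz; have ib := integrable_gB n Bz; rewrite -lee_fin.
apply: le_trans Bz; apply: le_trans (absg_le_Sg n z).
rewrite -abse_EFin EFin_Rintegral//.
apply: le_abse_integral => //; exact/measurable_EFinP.
Qed.

Let gB n (x : S * T) := \1_B x.1 * g n x.
(** The truncated fluctuation. The cut-off depends on the first coordinate alone, so the mean over
    the second one is still 0 for every [z]. *)
Let y n (x : S * T) := \1_B x.1 * (g n x - mean n x.1).

Let mindB : measurable_fun setT (fun x : S * T => \1_B x.1 : R).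
Proof. by apply: measurableT_comp => //; exact: measurable_indic. Qed.

Let mgB n : measurable_fun setT (gB n).
Proof. exact: measurable_funM. Qed.

Let my n : measurable_fun setT (y n).
Proof.
apply: measurable_funM => //; apply: measurable_funB => //.
exact: measurableT_comp.
Qed.

Let integrable_indB_g n z : mu.-integrable setT (EFin \o (fun u => gB n (z, u))).
Proof.
rewrite /gB; have [Bz|nBz] := pselect (B z).
  exact: (RintegrableZl (\1_B z) (integrable_gB n Bz)).
rewrite /= indicE memNset//=; under [X in EFin \o X]eq_fun do rewrite mul0r.
exact: finite_measure_integrable_cst.
Qed.

Let integrable_y n z : mu.-integrable setT (EFin \o (fun u => y n (z, u))).
Proof.
rewrite /y; have [Bz|nBz] := pselect (B z).
  exact: (RintegrableZl (\1_B z) (integrable_center (mean n z) (integrable_gB n Bz))).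
rewrite /= indicE memNset//=; under [X in EFin \o X]eq_fun do rewrite mul0r.
exact: finite_measure_integrable_cst.
Qed.

Let Rintegral_y n z : \int[mu]_u y n (z, u) = 0.
Proof.
rewrite /y; have [Bz|nBz] := pselect (B z).
  rewrite /= RintegralZl//; last by apply: integrable_center; exact: integrable_gB.
  by rewrite Rintegral_center ?mulr0//; exact: integrable_gB.
rewrite /= indicE memNset//=; under eq_Rintegral do rewrite mul0r.
by rewrite Rintegral_prob_cst.
Qed.

Let indB_sq z : \1_B z * \1_B z = \1_B z :> R.
Proof. by rewrite indicE; case: (_ \in _); rewrite ?mulr1 ?mulr0. Qed.

Let y_indB n x : \1_B x.1 * y n x = y n x.
Proof. by rewrite /y mulrA indB_sq. Qed.

(** On [B] the conditional mean is at most [K] in absolute value, and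
    [(g - m)^2 + (g + m)^2 = 2 g^2 + 2 m^2]. *)
Let y_sq_le n x : y n x ^+ 2 <= 2 * g n x ^+ 2 + 2 * K%:R ^+ 2.
Proof.
rewrite /y indicE; have [Bz|nBz] := pselect (B x.1); last first.
  by rewrite memNset// mul0r expr0n/= addr_ge0// mulr_ge0// sqr_ge0.
rewrite mem_set// mul1r; have := mean_le n Bz; rewrite ler_norml => /andP[h1 h2].
set m := mean n x.1 in h1 h2 *; have : m ^+ 2 <= K%:R ^+ 2 by nra.
have := sqr_ge0 (g n x + m); nra.
Qed.

Let integrable_cst_prod (k : R) : (nu \x mu)%E.-integrable setT (EFin \o (fun=> k)).
Proof.
have i1 : nu.-integrable setT (EFin \o (fun=> k)) by exact: finite_measure_integrable_cst.
have i2 : mu.-integrable setT (EFin \o (fun=> 1 : R)) by exact: finite_measure_integrable_cst.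
have := integrable_prodM i1 i2; apply: eq_integrable => // x _.
by rewrite /= mulr1.
Qed.

Let integrable_g2 n : (nu \x mu)%E.-integrable setT (EFin \o (fun x => g n x ^+ 2)).
Proof.
apply/integrable12ltyP; first by apply/measurable_EFinP; exact: measurable_funX.
by under eq_integral do under eq_integral do rewrite /= ger0_norm ?sqr_ge0//.
Qed.

Let integrable_y2 n : (nu \x mu)%E.-integrable setT (EFin \o (fun x => y n x ^+ 2)).
Proof.
apply: (@le_Rintegrable _ _ _ _ _ (fun x => 2 * g n x ^+ 2 + 2 * K%:R ^+ 2)).
- exact: measurable_funX.
- by move=> x; rewrite ger0_norm ?sqr_ge0.
- by apply: RintegrableD => //; exact: RintegrableZl.
Qed.

Let X1 n w := g n (zeta w, xi n w).
Let Y n w := y n (zeta w, xi n w).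

Let mY n : measurable_fun setT (Y n).
Proof. exact: (measurableT_comp (my n) (mpair1 n)). Qed.

Let iY2 n : P.-integrable setT (EFin \o (fun w => Y n w ^+ 2)).
Proof.
apply/(integrable_law (lam := (nu \x mu)%E) (mpair1 n) (law1 n) (F := fun x => y n x ^+ 2)) => //.
exact: measurable_funX.
Qed.

Let iX2 n : P.-integrable setT (EFin \o (fun w => X1 n w ^+ 2)).
Proof.
apply/(integrable_law (lam := (nu \x mu)%E) (mpair1 n) (law1 n) (F := fun x => g n x ^+ 2)) => //.
exact: measurable_funX.
Qed.

Let zero_mean1 n (a : S -> R) : measurable_fun setT a ->
  P.-integrable setT (EFin \o (fun w => a (zeta w) * Y n w)) ->
  \int[P]_w (a (zeta w) * Y n w) = 0.
Proof.
move=> ma; pose F (x : S * T) := a x.1 * y n x.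
have mF : measurable_fun setT F by apply: measurable_funM => //; exact: measurableT_comp.
move=> /(integrable_law (lam := (nu \x mu)%E) (mpair1 n) (law1 n) mF) iF.
rewrite (Rintegral_law (lam := (nu \x mu)%E) (mpair1 n) (law1 n) mF)//.
apply: Rintegral_prod_eq0 => // z.
rewrite -EFin_Rintegral; last exact: (RintegrableZl (a z) (integrable_y n z)).
by rewrite /F /= RintegralZl// Rintegral_y mulr0.
Qed.

(** Given [zeta] and [xi n], the variable [xi m] still has law [mu]; integrating it first
    annihilates [Y m]. With [p = y n] this is the orthogonality of the fluctuations, with [p = gB n]
    the vanishing of the off-diagonal terms of [X * Y m]. *)
Let zero_mean2 n m (p : S * T -> R) : n != m -> measurable_fun setT p ->
  (forall z, mu.-integrable setT (EFin \o (fun u => p (z, u)))) ->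
  P.-integrable setT (EFin \o (fun w => p (zeta w, xi n w) * Y m w)) ->
  \int[P]_w (p (zeta w, xi n w) * Y m w) = 0.
Proof.
move=> nm mp ip; pose F (x : S * (T * T)) := p (x.1, x.2.1) * y m (x.1, x.2.2).
have mF : measurable_fun setT F.
  apply: measurable_funM; [apply: (measurableT_comp mp)|apply: (measurableT_comp (my m))].
    by apply: measurable_fun_pair => //; apply: measurableT_comp => //; exact: measurable_fst.
  by apply: measurable_fun_pair => //; apply: measurableT_comp => //; exact: measurable_snd.
have law := fun A => @law2 n m A nm.
move=> /(integrable_law (lam := (nu \x prod_measure mu mu)%E) (mpair2 n m) law mF) iF.
rewrite (Rintegral_law (lam := (nu \x prod_measure mu mu)%E) (mpair2 n m) law mF)//.
apply: Rintegral_prod_eq0 => // z.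
have ipq := integrable_prodM (ip z) (integrable_y m z).
rewrite -[LHS](integral12_prod_meas1 (m1 := mu) (m2 := mu) ipq).
rewrite (eq_integral (cst 0%E)) ?integral0// => u _; rewrite /fubini_F /=.
rewrite -EFin_Rintegral; last exact: (RintegrableZl (p (z, u)) (integrable_y m z)).
by rewrite RintegralZl// Rintegral_y mulr0.
Qed.

Let EY n : \int[P]_w Y n w = 0.
Proof.
have i1 : P.-integrable setT (EFin \o (fun=> 1 ^+ 2 : R)) by exact: finite_measure_integrable_cst.
have := integrable_mul_sq (measurable_cst (1 : R)) (mY n) i1 (iY2 n).
move=> /(zero_mean1 (measurable_cst (1 : R))) E0.
by rewrite -[RHS]E0; apply: eq_Rintegral => w _; rewrite mul1r.
Qed.

Let EYY n m : n != m -> \int[P]_w (Y n w * Y m w) = 0.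
Proof.
move=> nm; apply: (zero_mean2 nm (my n) (integrable_y n)).
exact: (integrable_mul_sq (mY n) (mY m) (iY2 n) (iY2 m)).
Qed.

(** [Y n] already carries the indicator of [B]. The truncated [gB] has integrable sections at every
    [z], as [zero_mean2] requires, while [g] has them only for [z] in [B]. *)
Let X1Y_gB m n w : X1 m w * Y n w = gB m (zeta w, xi m w) * Y n w.
Proof. by rewrite /gB /Y -[in LHS]y_indB /X1 /=; ring. Qed.

Let integral_normy_le n z : (\int[mu]_u `|y n (z, u)|%:E <= (2 * K%:R)%:E)%E.
Proof.
have K2 : 0 <= 2 * K%:R :> R by rewrite mulr_ge0.
have [Bz|nBz] := pselect (B z); last first.
  rewrite (eq_integral (cst 0%E)) ?integral0 ?lee_fin// => u _.
  by rewrite /y /= indicE memNset// mul0r normr0.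
apply: (@le_trans _ _ (\int[mu]_u (`|g n (z, u)|%:E + K%:R%:E))%E).
  apply: ge0_le_integral => //.
  - by apply/measurable_EFinP; apply: measurableT_comp => //; exact: (measurableT_comp (my n)).
  - by apply: emeasurable_funD => //; apply/measurable_EFinP; exact: measurableT_comp.
  - move=> u _; rewrite -EFinD lee_fin /y /= indicE mem_set// mul1r.
    by apply: (le_trans (ler_normB _ _)); rewrite lerD2l mean_le.
rewrite ge0_integralD//; last by apply/measurable_EFinP; exact: measurableT_comp.
rewrite integral_cst// [X in (_ * X)%E](_ : _ = 1%E) ?mule1; last exact: probability_setT.
rewrite (_ : 2 * K%:R = K%:R + K%:R); last by ring.
by rewrite EFinD leeD2r// (le_trans (absg_le_Sg n z)).
Qed.

(** Given [zeta] the two factors are independent, so the conditional expectation of the product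
    splits; that of [|Y n|] is at most [2 K]. The bound is summable in [m]. *)
Let integral_X1Y_le m n : m != n ->
  (\int[P]_w `|X1 m w * Y n w|%:E <= (2 * K%:R)%:E * \int[nu]_z absg m z)%E.
Proof.
move=> mn; have K2 : 0 <= 2 * K%:R :> R by rewrite mulr_ge0.
pose F (x : S * (T * T)) := `|g m (x.1, x.2.1) * y n (x.1, x.2.2)|%:E.
have mF : measurable_fun setT F.
  apply/measurable_EFinP; apply: measurableT_comp => //.
  apply: measurable_funM; [apply: (measurableT_comp (mg m))|apply: (measurableT_comp (my n))].
    by apply: measurable_fun_pair => //; apply: measurableT_comp => //; exact: measurable_fst.
  by apply: measurable_fun_pair => //; apply: measurableT_comp => //; exact: measurable_snd.
have F0 x : (0 <= F x)%E by rewrite lee_fin.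
rewrite (ge0_integral_law (lam := (nu \x prod_measure mu mu)%E) (mpair2 m n) (fun A => @law2 m n A mn) mF F0).
rewrite (fubini_tonelli1 (m1 := nu) (m2 := prod_measure mu mu) _ mF F0).
rewrite -ge0_integralZl_EFin//.
apply: ge0_le_integral => //.
- by move=> z _; apply: integral_ge0.
- exact: (measurable_integral_snd (prod_measure mu mu) mF F0).
- exact: measurable_funeM.
move=> z _; rewrite /fubini_F /F /=.
rewrite [leLHS](fubini_tonelli1 (m1 := mu) (m2 := mu)
  (fun x : T * T => `|g m (z, x.1) * y n (z, x.2)|%:E))//; last first.
  exact: (measurableT_comp mF (pair1_measurable z)).
rewrite /fubini_F /=.
under eq_integral do under eq_integral do rewrite normrM.
rewrite (ge0_integral_prodM _ _ (f := fun u => `|g m (z, u)|) (g := fun u => `|y n (z, u)|))//.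
- rewrite muleC; apply: lee_wpmul2r; [exact: absg_ge0|exact: integral_normy_le].
- exact: measurableT_comp.
- by apply: measurableT_comp => //; exact: (measurableT_comp (my n)).
Qed.

Let integrable_X1Y m n : P.-integrable setT (EFin \o (fun w => X1 m w * Y n w)).
Proof.
have [->|mn] := eqVneq m n.
  exact: (integrable_mul_sq (mX1 n) (mY n) (iX2 n) (iY2 n)).
apply/integrableP; split; first exact/measurable_EFinP/(measurable_funM (mX1 m) (mY n)).
apply: (le_lt_trans (integral_X1Y_le mn)); apply: lte_mul_pinfty => //.
by apply: le_lt_trans integral_Sg; exact: ge0_le_integral.
Qed.

Let esum_X1Y n : (\esum_(m in [set: I]) \int[P]_w `|X1 m w * Y n w|%:E < +oo)%E.
Proof.
pose a m := (\int[P]_w `|X1 m w * Y n w|%:E)%E.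
pose b m := ((2 * K%:R)%:E * \int[nu]_z absg m z)%E.
have b0 m : (0 <= b m)%E.
  by rewrite mule_ge0 ?lee_fin ?mulr_ge0//; exact: integral_ge0.
have a0 m : (0 <= a m)%E by apply: integral_ge0 => w _; rewrite lee_fin.
(* The product bound fails to cover the dependent pair [m = n]; this single term is added
   separately, and it is finite by square integrability. *)
apply: (@le_lt_trans _ _ (\esum_(m in [set: I]) (b m + (if m \in [set n] then a m else 0)))%E).
  apply: le_esum => m _; have [->|mn] := eqVneq m n.
    by rewrite mem_set// leeDr.
  by case: ifPn => _; [rewrite lee_paddr//|rewrite adde0]; exact: integral_X1Y_le.
rewrite esumD//; last by move=> m _; case: ifP.
rewrite -esum_mkcond esum_set1// lte_add_pinfty//.
  by apply: lt_esumZl => // m; exact: integral_ge0.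
by have /integrableP[_] := integrable_X1Y n n.
Qed.

(** On the diagonal, [X1 n * Y n - Y n ^ 2] equals [mean n (zeta w) * Y n], a function of [zeta]
    times a conditionally centred variable, hence of mean 0. *)
Let Rintegral_X1Y m n : \int[P]_w (X1 m w * Y n w) =
  if m == n then \int[P]_w (Y n w ^+ 2) else 0.
Proof.
case: ifPn => [/eqP ->|mn]; last first.
  under eq_Rintegral do rewrite X1Y_gB.
  apply: zero_mean2 => //.
  by have := integrable_X1Y m n; apply: eq_integrable => // w _; rewrite /= X1Y_gB.
have iD := RintegrableB (integrable_X1Y n n) (iY2 n).
have E w : X1 n w * Y n w - Y n w ^+ 2 = mean n (zeta w) * Y n w.
  rewrite /Y expr2 -[in X in X - _ = _]y_indB -[in RHS]y_indB /y /X1 /=.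
  have := indB_sq (zeta w); set b := \1_B _ => bb.
  have -> : b * (g n (zeta w, xi n w) - mean n (zeta w)) * (b * (g n (zeta w, xi n w) - mean n (zeta w))) =
    (b * b) * (g n (zeta w, xi n w) - mean n (zeta w)) * (g n (zeta w, xi n w) - mean n (zeta w)) by ring.
  rewrite mulrA bb; ring.
have : \int[P]_w (X1 n w * Y n w - Y n w ^+ 2) = 0.
  under eq_Rintegral do rewrite E.
  apply: zero_mean1 => //; move: iD; apply: eq_integrable => // w _.
  by rewrite /= E.
by rewrite RintegralB// => /eqP; rewrite subr_eq0 => /eqP.
Qed.

Let integral_law1 m : (\int[P]_w `|X1 m w|%:E = \int[nu]_z absg m z)%E.
Proof.
have mF : measurable_fun setT (fun x => `|g m x|%:E).
  by apply/measurable_EFinP; exact: measurableT_comp.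
rewrite (ge0_integral_law (lam := (nu \x mu)%E) (mpair1 m) (law1 m) mF)//.
by rewrite fubini_tonelli1.
Qed.

Let summable_ae : {ae P, forall w, (\esum_(m in [set: I]) `|X1 m w|%:E < +oo)%E}.
Proof.
have mF m : measurable_fun setT (fun w => `|X1 m w|%:E).
  by apply/measurable_EFinP; exact: measurableT_comp (mX1 m).
have i : P.-integrable setT (fun w => \esum_(m in [set: I]) `|X1 m w|%:E).
  apply/integrableP; split; first exact: measurable_esum.
  under eq_integral do rewrite gee0_abs ?esum_ge0//.
  rewrite ge0_integral_esum//.
  by under eq_esum do rewrite integral_law1.
apply: filterS (integrable_ae measurableT i) => w /(_ Logic.I).
by rewrite ge0_fin_numE// esum_ge0.
Qed.

(** Dominated convergence for the partial sums of the series [X] multiplied by [Y n]; the dominating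
    function [G] is integrable by [esum_X1Y]. *)
Let XY_limit n : P.-integrable setT (EFin \o (fun w => X w * Y n w)) /\
  \int[P]_w (X w * Y n w) = \int[P]_w (Y n w ^+ 2).
Proof.
pose G w := \esum_(m in [set: I]) `|X1 m w * Y n w|%:E.
have mXY m : measurable_fun setT (fun w => X1 m w * Y n w).
  exact: (measurable_funM (mX1 m) (mY n)).
have mG0 m : measurable_fun setT (fun w => `|X1 m w * Y n w|%:E).
  by apply/measurable_EFinP; exact: measurableT_comp.
have iG : P.-integrable setT G.
  apply/integrableP; split; first exact: measurable_esum.
  under eq_integral do rewrite gee0_abs ?esum_ge0//.
  by rewrite ge0_integral_esum.
pose e k w := enum_val0 0 (fun m => X1 m w * Y n w) k.
have ie k : P.-integrable setT (EFin \o e k).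
  rewrite /e /enum_val0; case: pickle_inv => [m|] /=; first exact: integrable_X1Y.
  exact: finite_measure_integrable_cst.
pose f N w := \sum_(0 <= k < N) e k w.
have iff N : P.-integrable setT (EFin \o f N) by exact: Rintegrable_sum.
have fE N w : f N w = (\sum_(0 <= k < N) enum_val0 0 (fun m => X1 m w) k) * Y n w.
  rewrite mulr_suml; apply: eq_bigr => k _; rewrite /e /enum_val0.
  by case: pickle_inv => [m|]//=; rewrite mul0r.
have mXYn : measurable_fun setT (fun w => X w * Y n w) by exact: measurable_funM.
have [] := @dominated_convergence _ _ _ P setT measurableT (fun N => EFin \o f N)
  (EFin \o (fun w => X w * Y n w)) G _ _ _ iG _.
- by move=> N; exact: measurable_int (iff N).
- exact/measurable_EFinP.
- apply: filterS summable_ae => w sw _.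
  apply: cvg_EFin; first exact: nearW.
  rewrite (_ : fine \o _ = fun N => (\sum_(0 <= k < N) enum_val0 0 (fun m => X1 m w) k) * Y n w); last first.
    by apply/funext => N /=; exact: fE.
  by apply: cvgM; [exact: cvg_unordered_sum|exact: cvg_cst].
- apply: aeW => w N _; apply: le_trans (enum_sum_le N _) => //=.
  rewrite lee_fin; apply: (le_trans (ler_norm_sum _ _ _)).
  rewrite le_eqVlt; apply/orP; left; apply/eqP; apply: eq_bigr => k _.
  by rewrite /e /enum_val0; case: pickle_inv => [m|]//=; rewrite normr0.
move=> iXY _ cvg1; split=> //.
(* The integrals are constant once the partial sum includes the code of [n], since every other term
   has mean 0. *)
have cvg2 : (\int[P]_w (f N w)%:E)%E @[N --> \oo] --> (\int[P]_w (Y n w ^+ 2))%:E.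
  apply: cvg_near_cst; near=> N.
  rewrite -EFin_Rintegral// Rintegral_sum//; congr EFin.
  have nN : (choice.pickle n < N)%N by near: N; exact: nbhs_infty_gt.
  rewrite (bigD1_seq (choice.pickle n)) ?iota_uniq ?mem_index_iota//=.
  rewrite big1 ?addr0.
    under eq_Rintegral do rewrite /e enum_val0_pickle.
    by rewrite Rintegral_X1Y eqxx.
  move=> k kn; rewrite /e /enum_val0; case E : (pickle_inv k) => [m|]/=.
    rewrite Rintegral_X1Y; case: eqVneq => // mn; exfalso; move: kn.
    by rewrite -mn; have := @pickle_invK I k; rewrite E /= => ->; rewrite eqxx.
  by rewrite Rintegral_prob_cst.
apply: EFin_inj; rewrite -(cvg_unique _ cvg1 cvg2)// EFin_Rintegral//.
Unshelve. all: by end_near. Qed.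

Let y_sq_ge_gap n z : ((\1_B z)%:E * gap n z <= \int[mu]_u (y n (z, u) ^+ 2)%:E)%E.
Proof.
have [Bz|nBz] := pselect (B z); last first.
  by rewrite indicE memNset// mul0e; apply: integral_ge0 => u _; rewrite lee_fin sqr_ge0.
rewrite indicE mem_set// mul1e.
apply: le_trans (half_gap_le (integrable_gB n Bz)) _.
rewrite le_eqVlt; apply/orP; left; apply/eqP; apply: eq_integral => u _.
by rewrite /y indicE mem_set// mul1r.
Qed.

Lemma variance_ge_truncated_gap :
  (\int[nu]_z ((\1_B z)%:E * \esum_(n in [set: I]) gap n z) <= 'V_P[X])%E.
Proof.
have mBg n : measurable_fun setT (fun z => (\1_B z)%:E * gap n z)%E.
  by apply: emeasurable_funM => //; apply/measurable_EFinP; exact: measurable_indic.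
have Bg0 n z : (0 <= (\1_B z)%:E * gap n z)%E by rewrite mule_ge0// lee_fin.
rewrite (_ : (\int[nu]_z _ = \esum_(n in [set: I]) \int[nu]_z ((\1_B z)%:E * gap n z))%E); last first.
  rewrite -ge0_integral_esum//; apply: eq_integral => z _; rewrite indicE.
  case: (_ \in _); first by rewrite mul1e; apply: eq_esum => n _; rewrite mul1e.
  by rewrite mul0e esum1// => n _; rewrite mul0e.
apply: (@le_trans _ _ (\esum_(n in [set: I]) (\int[P]_w (Y n w ^+ 2))%:E)%E).
  apply: le_esum => n _; rewrite EFin_Rintegral//.
  have mF : measurable_fun setT (fun x => (y n x ^+ 2)%:E).
    by apply/measurable_EFinP; exact: measurable_funX.
  rewrite (ge0_integral_law (lam := (nu \x mu)%E) (mpair1 n) (law1 n) mF); last first.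
    by move=> x; rewrite lee_fin sqr_ge0.
  rewrite fubini_tonelli1//; last by move=> x; rewrite lee_fin sqr_ge0.
  apply: ge0_le_integral => //.
  apply: (measurable_integral_snd mu mF) => x; by rewrite lee_fin sqr_ge0.
(* The sum is a supremum over finite sets of indices, and the orthogonality bound holds for each of
   them. *)
apply: ge_ereal_sup => _ [A [finA _] <-]; rewrite fsbig_finite//= sumEFin.
apply: variance_ge_sum_orthogonal => //.
- by move=> n; have [] := XY_limit n.
- by move=> n; have [] := XY_limit n.
- exact: fset_uniq.
Qed.

End truncation.

(* [Var X >= E Var (X | zeta)], each conditional variance being half the mean
   squared gap of two independent copies. *)
Lemma variance_ge_esum_gap :
  (\esum_(n in [set: I]) \int[nu]_z \int[mu]_u \int[mu]_v
     (2^-1 * (g n (z, u) - g n (z, v)) ^+ 2)%:E <= 'V_P[X])%E.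
Proof.
pose Gap z := \esum_(n in [set: I]) gap n z.
pose B (K : nat) : set S := [set z | (Sg z <= K%:R%:E)%E].
have Gap0 z : (0 <= Gap z)%E by exact: esum_ge0.
have mGap : measurable_fun setT Gap by exact: measurable_esum.
have mB K : measurable (B K).
  rewrite (_ : B K = Sg @^-1` `]-oo, K%:R%:E]%classic); last first.
    by apply/seteqP; split => z /=; rewrite in_itv.
  by rewrite -[X in measurable X]setTI; apply: mSg => //; exact: emeasurable_itv.
pose D (K : nat) z := ((\1_(B K) z)%:E * Gap z)%E.
have mD K : measurable_fun setT (D K).
  by apply: emeasurable_funM => //; apply/measurable_EFinP; exact: measurable_indic.
have D0 K z : (0 <= D K z)%E by rewrite mule_ge0// lee_fin.
have ndD z : {homo D^~ z : K K' / (K <= K')%N >-> (K <= K')%E}.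
  move=> K K' KK'; rewrite lee_wpmul2r// lee_fin !indicE.
  have [BK|nBK] := pselect (B K z); last by rewrite memNset.
  rewrite mem_set// mem_set//; apply: (le_trans BK).
  by rewrite lee_fin ler_nat.
rewrite -ge0_integral_esum//.
have iSg : nu.-integrable setT Sg.
  apply/integrableP; split=> //.
  by under eq_integral do rewrite gee0_abs//.
(* The sets [B K] increase to the set where [Sg] is finite, which has full measure, so the
   truncation disappears in the limit. *)
rewrite (_ : (\int[nu]_z _ = \int[nu]_z (limn (D^~ z)))%E); last first.
  apply: ae_eq_integral => //.
    apply: (emeasurable_fun_cvg (fun K => D K)) => // z _.
    exact/ereal_nondecreasing_is_cvgn.
  apply: filterS (integrable_ae measurableT iSg) => z /(_ Logic.I) Sgz _.
  apply/esym/cvg_lim => //; apply: cvg_near_cst; near=> K.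
  rewrite /D indicE mem_set ?mul1e//= /B /=.
  rewrite -(fineK Sgz) lee_fin.
  by near: K; exact: nbhs_infty_ger.
rewrite monotone_convergence//.
apply: lime_le.
  apply: ereal_nondecreasing_is_cvgn => K K' KK'.
  by apply: ge0_le_integral => // z _; exact: ndD.
by apply: nearW => K; exact: variance_ge_truncated_gap.
Unshelve. all: by end_near. Qed.

End conditionally_independent_series.

(** * The stationarized lattice *)

Section joint_laws.
Context {disp : measure_display} {Omega : measurableType disp} {R : realType}
  {P : probability Omega R} {d0 : measure_display} {T : measurableType d0}
  {I : choiceType} (xi : I -> {RV P >-> T}) (zeta : {RV P >-> T}).
Variable mu : probability T R.
Hypothesis xi_law : forall n A, measurable A -> P (xi n @^-1` A) = mu A.

(** With [Omega] given the sigma-algebra generated by the family, both components are measurable and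
    therefore so is the pair. This brings arbitrary events of two of the [xi] within reach of the
    independence of [zeta], not only boxes. *)
Lemma generated_by_pair n m (C : set (T * T)) : measurable C ->
  generated_by xi ((fun w => (xi n w, xi m w)) @^-1` C).
Proof.
move=> mC.
pose G : set (set Omega) := \bigcup_i preimage_set_system setT (xi i) measurable.
have mxi k : measurable_fun setT (xi k : g_sigma_algebraType G -> T).
  move=> _ B mB; apply: sub_sigma_algebra.
  by exists k => //; exists B.
have := measurable_fun_pair (mxi n) (mxi m).
by move=> /(_ measurableT C mC); rewrite setTI.
Qed.

Lemma generated_by_one n (B : set T) : measurable B -> generated_by xi (xi n @^-1` B).
Proof.
move=> mB; apply: sub_sigma_algebra; exists n => //; exists B => //.
by rewrite setTI.
Qed.

(** A product measure is determined on boxes, where independence over the two-element set of indices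
    gives the product. *)
Lemma pair_law n m : mutually_independent xi -> n != m ->
  forall C, measurable C ->
  P ((fun w => (xi n w, xi m w)) @^-1` C) = (mu \x mu)%E C.
Proof.
move=> ind nm C mC.
have mp : measurable_fun setT (fun w => (xi n w, xi m w)) by exact: measurable_fun_pair.
symmetry; apply: (product_measure_unique (m1 := mu) (m2 := mu) (m' := image_measure P mp)) => // A B mA mB.
rewrite -[LHS]/(P _).
pose F k := if k == n then A else B.
have mF k : measurable (F k) by rewrite /F; case: ifP.
have := ind [fset n; m]%fset F mF.
rewrite big_fsetU1 ?inE// big_seq_fset1 /F eqxx eq_sym (negbTE nm) !xi_law// => <-.
congr (P _); apply/seteqP; split=> w /=.
  move=> [An Bm] k /=; rewrite !inE => /orP[/eqP ->|/eqP ->]; first by rewrite eqxx.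
  by rewrite eq_sym (negbTE nm).
move=> H; split.
  by have := H n; rewrite /= !inE eqxx; apply.
by have := H m; rewrite /= !inE eqxx orbT eq_sym (negbTE nm); apply.
Qed.

Hypothesis zeta_indep : independent_of_family zeta xi.

Lemma joint_law1 n A : measurable A ->
  P ((fun w => (zeta w, xi n w)) @^-1` A) = (distribution P zeta \x mu)%E A.
Proof.
move=> mA.
have mp : measurable_fun setT (fun w => (zeta w, xi n w)) by exact: measurable_fun_pair.
symmetry; apply: (product_measure_unique (m1 := distribution P zeta) (m2 := mu) (m' := image_measure P mp)) => // B C mB mC.
have := zeta_indep mB (generated_by_one n mC).
by rewrite (xi_law n mC).
Qed.

Lemma joint_law2 n m A : mutually_independent xi -> n != m -> measurable A ->
  P ((fun w => (zeta w, (xi n w, xi m w))) @^-1` A) =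
  (distribution P zeta \x prod_measure mu mu)%E A.
Proof.
move=> ind nm mA.
have mp : measurable_fun setT (fun w => (zeta w, (xi n w, xi m w))).
  by apply: measurable_fun_pair => //; exact: measurable_fun_pair.
symmetry; apply: (product_measure_unique (m1 := distribution P zeta) (m2 := prod_measure mu mu) (m' := image_measure P mp)) => // B C mB mC.
have := zeta_indep mB (generated_by_pair n m mC).
by rewrite (pair_law ind nm mC).
Qed.

End joint_laws.

(** Brings the outermost variable innermost: once to tile the space by the uniform shift, once to
    integrate over the frequency. *)
Lemma tonelli3 (R : realType) d1 d2 (S : measurableType d1) (T : measurableType d2)
    (nu : {sigma_finite_measure set S -> \bar R})
    (mu : {sigma_finite_measure set T -> \bar R}) (F : S * T * T -> \bar R) :
  measurable_fun setT F -> (forall x, (0 <= F x)%E) ->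
  (\int[nu]_z \int[mu]_u \int[mu]_v F (z, u, v) =
   \int[mu]_u \int[mu]_v \int[nu]_z F (z, u, v))%E.
Proof.
move=> mF F0.
have mG := measurable_integral_snd mu mF F0.
rewrite (fubini_tonelli (m1 := nu) (m2 := mu) (fun x => \int[mu]_v F (x, v))%E)//; last first.
  by move=> x; apply: integral_ge0.
apply: eq_integral => u _.
rewrite (fubini_tonelli (m1 := nu) (m2 := mu) (fun x => F (x.1, u, x.2)))//.
apply: (measurableT_comp mF); apply: measurable_fun_pair => //.
by apply: measurable_fun_pair.
Qed.

(** * From the lattice sum to the spectrum of [h] *)

Section stationary.
Context {R : realType} (d : nat).
Local Notation L := (@lebesgue_vec R d).
Variables (nu mu : probability (d.-tuple R) R) (a : R).
Hypothesis a0 : 0 < a.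
Hypothesis muE : forall A, measurable A ->
  mu A = (\int[L]_(x in A) (gauss_density a x)%:E)%E.
Hypothesis nuE : forall A, measurable A -> nu A = L (A `&` @unit_cube R d).

(** Up to a null set the uniform law has the indicator of the half-open cube as density, so
    averaging over the shift turns the lattice sum into an exact integral over the space. *)
Lemma ge0_integral_tiling_law (F : d.-tuple R -> \bar R) :
  measurable_fun setT F -> (forall x, (0 <= F x)%E) ->
  (\esum_(n in [set: d.-tuple int]) \int[nu]_z F (vadd (@vint R d n) z) =
   \int[L]_x F x)%E.
Proof.
move=> mF F0; rewrite -ge0_integral_tiling//; apply: eq_esum => n _.
have mH := @measurable_half_open_cube R d.
rewrite (ge0_integral_density (mu := L) (phi := \1_(@half_open_cube R d)))//.
- move=> A mA; rewrite integral_indic// setIC.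
  exact: etrans (nuE mA) (lebesgue_cubeI mA).
- by apply: (measurableT_comp mF); exact: measurable_vadd.
Qed.

Variables (h : d.-tuple R -> R) (r : R).
Hypothesis ih1 : L.-integrable setT (EFin \o h).
Hypothesis r0 : 0 < r.

Let mh : measurable_fun setT h. Proof. exact: Rintegrable_measurable ih1. Qed.

(** The first component is the uniform shift and the second the Gaussian displacement. They are
    added in the order of [Ws], so that the series of the variance bound is [Ns] by conversion. *)
Definition summand (n : d.-tuple int) (x : d.-tuple R * d.-tuple R) : R :=
  h (vscale r^-1 (vadd (vadd (@vint R d n) x.2) x.1)).

Let measurable_dilate_add d0 (U : measurableType d0) (z u : U -> d.-tuple R) :
  measurable_fun setT z -> measurable_fun setT u ->
  measurable_fun setT (fun w => h (vscale r^-1 (vadd (z w) (u w)))).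
Proof.
move=> mz mu_; apply: (measurableT_comp mh); apply: measurable_vscale.
exact: measurable_vadd.
Qed.

Lemma measurable_summand n : measurable_fun setT (summand n).
Proof.
apply: measurable_dilate_add => //; apply: measurable_vadd => //.
Qed.

Lemma summandE n z u : summand n (z, u) = h (vscale r^-1 (vadd (vadd (@vint R d n) z) u)).
Proof.
congr (h _); apply: eq_from_tnth => i; rewrite !tnth_mktuple.
by rewrite addrAC.
Qed.

(** For each fixed displacement [u] the shifted lattice tiles the space; the translation by [u]
    costs nothing and the dilation by [r] gives [r ^ d]. The absolute value and the square as [f]
    give the summability that the variance bound assumes. *)
Lemma esum_summand (f : R -> R) : measurable_fun setT f -> (forall x, 0 <= f x) ->
  (\esum_(n in [set: d.-tuple int]) \int[nu]_z \int[mu]_u (f (summand n (z, u)))%:E =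
   (r ^+ d)%:E * \int[L]_x (f (h x))%:E)%E.
Proof.
move=> mf f0.
have mfs n : measurable_fun setT (fun x => (f (summand n x))%:E).
  by apply/measurable_EFinP; apply: (measurableT_comp mf); exact: measurable_summand.
transitivity (\esum_(n in [set: d.-tuple int]) \int[mu]_u \int[nu]_z (f (summand n (z, u)))%:E)%E.
  apply: eq_esum => n _.
  rewrite (fubini_tonelli (m1 := nu) (m2 := mu) (fun x => (f (summand n x))%:E))//.
  by move=> x; rewrite lee_fin.
rewrite -ge0_integral_esum; last 2 first.
- by move=> n; apply: (measurable_integral_fst nu (mfs n)) => x; rewrite lee_fin.
- by move=> n u; apply: integral_ge0 => z _; rewrite lee_fin.
transitivity (\int[mu]_u ((r ^+ d)%:E * \int[L]_x (f (h x))%:E))%E; last first.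
  rewrite integral_cst// [X in (_ * X)%E](_ : _ = 1%E) ?mule1//; exact: probability_setT.
apply: eq_integral => u _.
transitivity (\int[L]_x (f (h (vscale r^-1 (vadd x u))))%:E)%E.
  rewrite -ge0_integral_tiling_law; last 2 first.
  - by apply/measurable_EFinP; apply: (measurableT_comp mf); exact: measurable_dilate_add.
  - by move=> x; rewrite lee_fin.
  by apply: eq_esum => n _; apply: eq_integral => z _; rewrite summandE.
have rV : 0 < r^-1 by rewrite invr_gt0.
rewrite (ge0_integral_affine_vec (vscale r^-1 u) rV (f := fun x => (f (h x))%:E)); last 2 first.
- by apply/measurable_EFinP; exact: (measurableT_comp mf).
- by move=> x; rewrite lee_fin.
rewrite muleA -EFinM -exprMn divff ?gt_eqF// expr1n mul1e.
apply: eq_integral => x _; congr (f (h _))%:E.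
by apply: eq_from_tnth => i; rewrite !tnth_mktuple mulrDr.
Qed.

(** The tiling needs [z] innermost and the Gaussian average needs [l] outermost, so both sides are
    rewritten with [u], [v] outside. There the integrands are compared for each fixed pair, by
    Bessel's inequality for a difference of translates. *)
Lemma esum_gap_ge :
  ((r ^+ d)%:E * \int[L]_l (power_spectrum h l *
      (1 - expR (- (2 * pi ^+ 2 * a * (inner l l / r ^+ 2)))))%:E <=
   \esum_(n in [set: d.-tuple int]) \int[nu]_z \int[mu]_u \int[mu]_v
     (2^-1 * (summand n (z, u) - summand n (z, v)) ^+ 2)%:E)%E.
Proof.
pose F n (x : d.-tuple R * d.-tuple R * d.-tuple R) :=
  (2^-1 * (summand n x.1 - summand n (x.1.1, x.2)) ^+ 2)%:E.
have F0 n x : (0 <= F n x)%E by rewrite lee_fin mulr_ge0// sqr_ge0.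
have mF n : measurable_fun setT (F n).
  apply/measurable_EFinP; apply: measurable_funM => //; apply: measurable_funX.
  apply: measurable_funB.
    by apply: (measurableT_comp (measurable_summand n)); exact: measurable_fst.
  apply: (measurableT_comp (measurable_summand n)); apply: measurable_fun_pair => //.
  by apply: measurableT_comp => //; exact: measurable_fst.
rewrite (_ : \esum_(n in _) _ = \int[mu]_u \int[mu]_v \esum_(n in [set: d.-tuple int])
    \int[nu]_z F n (z, u, v))%E; last first.
  rewrite (eq_esum (b := fun n => \int[mu]_u \int[mu]_v \int[nu]_z F n (z, u, v))%E); last first.
    by move=> n _; exact: tonelli3.
  pose Q n (x : d.-tuple R * d.-tuple R) := (\int[nu]_z F n (z, x.1, x.2))%E.
  have mQ n : measurable_fun setT (Q n).
    apply: (measurable_integral_fst nu (G := fun y => F n (y.1, y.2.1, y.2.2))) => //.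
    apply: (measurableT_comp (mF n)); apply: measurable_fun_pair.
      apply: measurable_fun_pair => //.
      by apply: measurableT_comp => //; exact: measurable_snd.
    by apply: measurableT_comp => //; exact: measurable_snd.
  have Q0 n x : (0 <= Q n x)%E by exact: integral_ge0.
  have mQ2 n : measurable_fun setT (fun u => \int[mu]_v Q n (u, v))%E.
    exact: (measurable_integral_snd mu (mQ n)).
  have Q20 n u : (0 <= \int[mu]_v Q n (u, v))%E.
    by apply: integral_ge0 => v _; exact: (Q0 n (u, v)).
  transitivity (\esum_(n in [set: d.-tuple int]) \int[mu]_u \int[mu]_v Q n (u, v))%E => //.
  rewrite -(ge0_integral_esum mu mQ2 Q20); apply: eq_integral => u _.
  rewrite -(ge0_integral_esum mu (f := fun n v => Q n (u, v)))//.
  by move=> n; exact: (measurableT_comp (mQ n) (pair1_measurable u)).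
(* The spectral integrand before averaging over [u] and [v]: 1/2 comes from the gap, [r ^ d] from
   the dilation. *)
pose D (x : d.-tuple R * d.-tuple R * d.-tuple R) :=
  (2^-1 * r ^+ d * (power_spectrum h x.1.1 *
     phase_gap x.1.1 (vscale r^-1 x.1.2) (vscale r^-1 x.2)))%:E.
have rd0 : 0 <= 2^-1 * r ^+ d by rewrite mulr_ge0// exprn_ge0// ltW.
have D0 x : (0 <= D x)%E.
  by rewrite lee_fin mulr_ge0// mulr_ge0 ?power_spectrum_ge0 ?phase_gap_ge0.
have mpair : measurable_fun setT (fun x : d.-tuple R * d.-tuple R * d.-tuple R => x.1.1).
  by apply: measurableT_comp => //; exact: measurable_fst.
have mpair2 : measurable_fun setT (fun x : d.-tuple R * d.-tuple R * d.-tuple R => x.1.2).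
  by apply: measurableT_comp => //; exact: measurable_fst.
have mgapf d0 (U : measurableType d0) (l s t : U -> d.-tuple R) :
    measurable_fun setT l -> measurable_fun setT s -> measurable_fun setT t ->
    measurable_fun setT (fun x => phase_gap (l x) (s x) (t x)).
  move=> ml ms mt; apply: measurable_funD; apply: measurable_funX; apply: measurable_funB;
    by [exact: measurable_cos_inner2|exact: measurable_sin_inner].
have mps := measurable_power_spectrum mh.
have mD : measurable_fun setT D.
  apply/measurable_EFinP; apply: measurable_funM => //; apply: measurable_funM.
    exact: (measurableT_comp mps).
  by apply: mgapf => //; exact: measurable_vscale.
apply: (@le_trans _ _ (\int[mu]_u \int[mu]_v \int[L]_l D (l, u, v)))%E.
  rewrite -tonelli3// -ge0_integralZl_EFin//; last 3 first.
  - move=> l _; rewrite lee_fin mulr_ge0 ?power_spectrum_ge0// subr_ge0 -[leRHS]expR0 ler_expR oppr_le0.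
    by rewrite !mulr_ge0 ?invr_ge0 ?inner_ge0 ?sqr_ge0 ?(ltW a0)// ltW// pi_gt0.
  - apply/measurable_EFinP; apply: measurable_funM => //; apply: measurable_funB => //.
    apply: measurableT_comp => //; apply: measurableT_comp => //.
    apply: measurable_funM => //; apply: measurable_funM => //; exact: measurable_inner.
  - by rewrite exprn_ge0// ltW.
  rewrite le_eqVlt; apply/orP; left; apply/eqP; apply: eq_integral => l _.
  set p := power_spectrum h l.
  have p0 : 0 <= 2^-1 * r ^+ d * p by rewrite mulr_ge0// power_spectrum_ge0.
  transitivity ((2^-1 * r ^+ d * p)%:E * \int[mu]_u \int[mu]_v
     (phase_gap l (vscale r^-1 u) (vscale r^-1 v))%:E)%E.
    by rewrite (integral_gaussian_law_phase_gap a0 muE) -!EFinM; congr EFin; field.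
  have mpg : measurable_fun setT (fun x : d.-tuple R * d.-tuple R =>
      (phase_gap l (vscale r^-1 x.1) (vscale r^-1 x.2))%:E).
    apply/measurable_EFinP; apply: mgapf => //; exact: measurable_vscale.
  have pg0 x : (0 <= (phase_gap l (vscale r^-1 x.1) (vscale r^-1 x.2))%:E)%E.
    by rewrite lee_fin phase_gap_ge0.
  rewrite -ge0_integralZl_EFin//; last 2 first.
  - by move=> u _; apply: integral_ge0 => v _; rewrite lee_fin phase_gap_ge0.
  - exact: (measurable_integral_snd mu mpg).
  apply: eq_integral => u _; rewrite -ge0_integralZl_EFin//; last 2 first.
  - by move=> v _; rewrite lee_fin phase_gap_ge0.
  - exact: (measurableT_comp mpg (pair1_measurable u)).
  by apply: eq_integral => v _; rewrite /D /= -EFinM mulrA.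
have DF u v : (\int[L]_l D (l, u, v) <=
    \esum_(n in [set: d.-tuple int]) \int[nu]_z F n (z, u, v))%E.
  (* With [u] and [v] fixed the summand depends on [n] and [z] only through [n + z], which is what
     the tiling integrates. *)
  pose H x := (2^-1 * (h (vscale r^-1 (vadd x u)) - h (vscale r^-1 (vadd x v))) ^+ 2)%:E.
  have mdiff : measurable_fun setT (fun x : d.-tuple R =>
      ((h (vscale r^-1 (vadd x u)) - h (vscale r^-1 (vadd x v))) ^+ 2)%:E).
    apply/measurable_EFinP; apply: measurable_funX.
    by apply: measurable_funB; exact: measurable_dilate_add.
  have mH : measurable_fun setT H.
    by rewrite /H; under eq_fun do rewrite EFinM; exact: measurable_funeM.
  have H0 x : (0 <= H x)%E by rewrite lee_fin mulr_ge0// sqr_ge0.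
  rewrite (eq_esum (b := fun n => \int[nu]_z H (vadd (@vint R d n) z))%E); last first.
    by move=> n _; apply: eq_integral => z _; rewrite /F /H /= !summandE.
  rewrite ge0_integral_tiling_law// /H.
  under [leRHS]eq_integral do rewrite EFinM.
  rewrite ge0_integralZl_EFin//; last by move=> x _; rewrite lee_fin sqr_ge0.
  rewrite ge0_integral_dilate_difference// muleA -EFinM.
  apply: (@le_trans _ _ ((2^-1 * r ^+ d)%:E * \int[L]_l (power_spectrum h l *
      phase_gap l (vscale r^-1 u) (vscale r^-1 v))%:E)%E); last first.
    by apply: lee_wpmul2l => //; exact: bessel_difference.
  rewrite -ge0_integralZl_EFin//.
  - by move=> l _; rewrite lee_fin mulr_ge0 ?power_spectrum_ge0 ?phase_gap_ge0.
  - by apply/measurable_EFinP; apply: measurable_funM => //; exact: mgapf.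
have mDint : measurable_fun setT (fun x : d.-tuple R * d.-tuple R => \int[L]_l D (l, x.1, x.2))%E.
  apply: (measurable_integral_fst L (G := fun y => D (y.1, y.2.1, y.2.2))) => //.
  apply: (measurableT_comp mD); apply: measurable_fun_pair.
    apply: measurable_fun_pair => //.
    by apply: measurableT_comp => //; exact: measurable_snd.
  by apply: measurableT_comp => //; exact: measurable_snd.
have mFint : measurable_fun setT (fun x : d.-tuple R * d.-tuple R =>
    \esum_(n in [set: d.-tuple int]) \int[nu]_z F n (z, x.1, x.2))%E.
  apply: measurable_esum; last by move=> n x; exact: integral_ge0.
  move=> n; apply: (measurable_integral_fst nu (G := fun y => F n (y.1, y.2.1, y.2.2))) => //.
  apply: (measurableT_comp (mF n)); apply: measurable_fun_pair.
    apply: measurable_fun_pair => //.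
    by apply: measurableT_comp => //; exact: measurable_snd.
  by apply: measurableT_comp => //; exact: measurable_snd.
have Dint0 (x : d.-tuple R * d.-tuple R) : (0 <= \int[L]_l D (l, x.1, x.2))%E by exact: integral_ge0.
have Fint0 (x : d.-tuple R * d.-tuple R) :
  (0 <= \esum_(n in [set: d.-tuple int]) \int[nu]_z F n (z, x.1, x.2))%E.
  by apply: esum_ge0 => n _; exact: integral_ge0.
have iD u : (0 <= \int[mu]_v \int[L]_l D (l, u, v))%E.
  by apply: integral_ge0 => v _; exact: (Dint0 (u, v)).
apply: ge0_le_integral => //.
- exact: (measurable_integral_snd mu mDint).
- exact: (measurable_integral_snd mu mFint).
move=> u _; apply: ge0_le_integral => //.
- by move=> v _; exact: (Dint0 (u, v)).
- exact: (measurableT_comp mDint (pair1_measurable u)).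
- exact: (measurableT_comp mFint (pair1_measurable u)).
Qed.

End stationary.

(** * From the Gaussian spectral weight to the two frequency regions *)

Section spectral_weight.
Context {R : realType} (d : nat).
Local Notation L := (@lebesgue_vec R d).

(** From [expR x >= 1 + x] the right-hand side is at least [k * q / (1 + k * q)]. For [q >= 1] this
    increasing function is at least its value at 1; for [q <= 1] the denominator is at most
    [1 + k]. *)
Lemma one_sub_expRN_ge (k q : R) : 0 < k -> 0 <= q ->
  k / (1 + k) * Num.min 1 q <= 1 - expR (- (k * q)).
Proof.
move=> k0 q0; have k1 : 0 < 1 + k by rewrite addr_gt0.
have kq1 : 0 < 1 + k * q by rewrite ltr_pwDl// mulr_ge0// ltW.
have e1 : expR (- (k * q)) <= (1 + k * q)^-1.
  by rewrite expRN lef_pV2 ?posrE ?expR_gt0// expR_ge1Dx.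
apply: (@le_trans _ _ (1 - (1 + k * q)^-1)); last by rewrite lerB.
have -> : 1 - (1 + k * q)^-1 = k * q / (1 + k * q) by field; rewrite gt_eqF.
rewrite mulrAC ler_pdivrMr// mulrAC ler_pdivlMr// -!mulrA ler_pM2l//.
have [q1|q1] := leP 1 q; first by lra.
by rewrite ler_wpM2l// lerD2l ler_piMr// ltW.
Qed.

(** The minimum of 1 and [|l|^2 / r^2] is the second on the ball and the first outside. Each
    regional integral is bounded by the full integral [W] on its own, so their sum is at most [2 W];
    this is the origin of the final 1/2, and the two regions may share the sphere. *)
Lemma spectral_weight_ge (p : d.-tuple R -> R) (k r : R) : 0 < k -> 0 < r ->
  measurable_fun setT p -> (forall l, 0 <= p l) ->
  ((k / (1 + k) / 2)%:E *
     ((r ^ (d%:Z - 2))%:E *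
        \int[L]_(l in [set l | (enorm l <= r)%R]) (p l * enorm l ^+ 2)%:E +
      (r ^+ d)%:E * \int[L]_(l in [set l | (enorm l >= r)%R]) (p l)%:E) <=
   (r ^+ d)%:E * \int[L]_l (p l * (1 - expR (- (k * (inner l l / r ^+ 2)))))%:E)%E.
Proof.
move=> k0 r0 mp p0; set c := k / (1 + k).
have c0 : 0 <= c by rewrite divr_ge0 ?addr_ge0 ?ltW.
have menorm : measurable_fun setT (@enorm R d).
  apply: (@measurableT_comp _ _ _ _ _ _ (@Num.sqrt R)); last exact: measurable_inner.
  by apply: continuous_measurable_fun; exact: sqrt_continuous.
have m_le : measurable [set l : d.-tuple R | enorm l <= r].
  rewrite (_ : [set l | _] = @enorm R d @^-1` `]-oo, r]%classic).
    by rewrite -[X in measurable X]setTI; apply: menorm => //; exact: measurable_itv.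
  by apply/seteqP; split => l /=; rewrite in_itv.
have m_ge : measurable [set l : d.-tuple R | r <= enorm l].
  rewrite (_ : [set l | _] = @enorm R d @^-1` `[r, +oo[%classic).
    by rewrite -[X in measurable X]setTI; apply: menorm => //; exact: measurable_itv.
  by apply/seteqP; split => l /=; rewrite in_itv/= andbT.
set W := (_ * \int[L]_l _)%E.
have rd0 : 0 < r ^+ d by rewrite exprn_gt0.
pose w l := p l * (1 - expR (- (k * (inner l l / r ^+ 2)))).
have q0 (l : d.-tuple R) : 0 <= inner l l / r ^+ 2 by rewrite divr_ge0 ?inner_ge0 ?sqr_ge0.
have wge l : p l * (c * Num.min 1 (inner l l / r ^+ 2)) <= w l.
  by rewrite ler_wpM2l// one_sub_expRN_ge.
have w0 l : 0 <= w l.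
  apply: le_trans (wge l); rewrite mulr_ge0// mulr_ge0// le_min ler01.
  exact: q0.
have mw : measurable_fun setT (fun l => (w l)%:E).
  apply/measurable_EFinP; apply: measurable_funM => //; apply: measurable_funB => //.
  apply: measurableT_comp => //; apply: measurableT_comp => //.
  by apply: measurable_funM => //; apply: measurable_funM => //; exact: measurable_inner.
(* Common to both regions: compare pointwise on [A], then enlarge the domain of the nonnegative
   integrand to the whole space. *)
have sub (A : set (d.-tuple R)) (f : d.-tuple R -> R) (x : R) : measurable A ->
    measurable_fun setT f -> (forall l, 0 <= f l) -> 0 <= x ->
    (forall l, A l -> c * (x * f l) <= r ^+ d * w l) ->
    (c%:E * (x%:E * \int[L]_(l in A) (f l)%:E) <= W)%E.
  move=> mA mf f0 x0 fw.
  have mfA : measurable_fun A (fun l => (f l)%:E) by apply/measurable_EFinP; exact: measurable_funTS.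
  rewrite muleA -EFinM -ge0_integralZl_EFin//; last first.
  - by rewrite mulr_ge0.
  - by move=> l _; rewrite lee_fin.
  rewrite /W -ge0_integralZl_EFin//; last 2 first.
  - by move=> l _; rewrite lee_fin; exact: w0.
  - exact: ltW.
  apply: (@le_trans _ _ (\int[L]_(l in A) ((r ^+ d)%:E * (w l)%:E))%E).
    apply: ge0_le_integral => //.
    - by move=> l _; rewrite -EFinM lee_fin mulr_ge0// mulr_ge0.
    - exact: measurable_funeM.
    - by apply: measurable_funeM; exact: measurable_funTS.
    - by move=> l Al; rewrite -!EFinM lee_fin -mulrA; exact: fw.
  apply: ge0_subset_integral => //.
  - exact: measurable_funeM.
  - by move=> l _; rewrite -EFinM lee_fin mulr_ge0// ltW.
have A1 : (c%:E * ((r ^ (d%:Z - 2))%:E *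
    \int[L]_(l in [set l | (enorm l <= r)%R]) (p l * enorm l ^+ 2)%:E) <= W)%E.
  apply: sub => //.
  - by apply: measurable_funM => //; exact: measurable_funX.
  - by move=> l; rewrite mulr_ge0// sqr_ge0.
  - by rewrite exprz_ge0// ltW.
  (* The exponent [d - 2] is an integer that is negative for [d = 1]; it is split as
     [r ^ d / r ^ 2]. *)
  move=> l /= lr; rewrite expfzDr ?gt_eqF// -exprnP -invr_expz -exprnP.
  rewrite (_ : c * _ = r ^+ d * (p l * (c * (enorm l ^+ 2 / r ^+ 2)))); last by ring.
  rewrite ler_pM2l//; apply: le_trans (wge l).
  rewrite enorm_sq min_r// ler_pdivrMr ?exprn_gt0// mul1r -enorm_sq.
  by rewrite ler_pXn2r// nnegrE ?sqrtr_ge0// ltW.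
have A2 : (c%:E * ((r ^+ d)%:E *
    \int[L]_(l in [set l | (enorm l >= r)%R]) (p l)%:E) <= W)%E.
  apply: sub => //; first exact: ltW.
  move=> l /= lr; rewrite mulrCA ler_pM2l//; apply: le_trans (wge l).
  rewrite min_l ?mulr1; first by rewrite mulrC.
  rewrite ler_pdivlMr ?exprn_gt0// mul1r -enorm_sq.
  by rewrite ler_pXn2r// nnegrE ?sqrtr_ge0// ltW.
set A := (_ * \int[L]_(l in _) _)%E in A1 *; set B := (_ * \int[L]_(l in _) _)%E in A2 *.
have A0 : (0 <= A)%E.
  rewrite mule_ge0//; first by rewrite lee_fin exprz_ge0// ltW.
  by apply: integral_ge0 => l _; rewrite lee_fin mulr_ge0// sqr_ge0.
have B0 : (0 <= B)%E.
  rewrite mule_ge0//; first by rewrite lee_fin ltW.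
  by apply: integral_ge0 => l _; rewrite lee_fin.
have W0 : (0 <= W)%E.
  rewrite mule_ge0//; first by rewrite lee_fin ltW.
  by apply: integral_ge0 => l _; rewrite lee_fin; exact: w0.
have h0 : (0 <= (2^-1)%:E :> \bar R)%E by rewrite lee_fin.
rewrite mulrC EFinM -muleA ge0_muleDr//.
apply: (@le_trans _ _ ((2^-1)%:E * (W + W))%E).
  by apply: lee_wpmul2l => //; exact: leeD.
by rewrite -mule2n -mule_natl muleA -EFinM mulVf// mul1e.
Qed.

End spectral_weight.

Unset Implicit Arguments.

Theorem mainTheorem8 (R : realType) (d : nat) (a : R)
    (hd : (1 <= d)%N) (ha : 0 < a) :
  exists2 c : R, 0 < c &
    forall (disp : measure_display) (Omega : measurableType disp)
      (P : probability Omega R)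
      (xi : d.-tuple int -> {RV P >-> d.-tuple R})
      (zeta : {RV P >-> d.-tuple R}),
    stationary_model a xi zeta ->
    forall h : d.-tuple R -> R,
    h \in Lfun (@lebesgue_vec R d) 1%E ->
    h \in Lfun (@lebesgue_vec R d) 2%:E ->
    forall r : R, 0 < r ->
    ('V_P[Ns (fun n => xi n) zeta h r] >=
     c%:E *
     ((r ^ (d%:Z - 2))%:E *
        \int[@lebesgue_vec R d]_(l in [set l | (enorm l <= r)%R])
          (ComplexField.Normc.normc (fourier h l) ^+ 2 * enorm l ^+ 2)%:E +
      (r ^+ d)%:E *
        \int[@lebesgue_vec R d]_(l in [set l | (enorm l >= r)%R])
          (ComplexField.Normc.normc (fourier h l) ^+ 2)%:E))%E.
Proof.
(* The decay rate in [|l|^2 / r^2] of the averaged phase gap. *)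
pose k : R := 2 * pi ^+ 2 * a.
have k0 : 0 < k by rewrite mulr_gt0// mulr_gt0// exprn_gt0// pi_gt0.
exists (k / (1 + k) / 2); first by rewrite !divr_gt0// addr_gt0.
move=> disp Omega P xi zeta [xi_indep xi_dens zeta_unif zeta_indep] h h1 h2 r r0.
have ih1 : (@lebesgue_vec R d).-integrable setT (EFin \o h) by exact/Lfun1_integrable.
have mh := Rintegrable_measurable ih1.
have ih2 := Lfun2_integrable_sqr h2.
(* All displacements have the same density, hence one law; the one at the origin represents it. *)
pose n0 : d.-tuple int := [tuple 0 | i < d].
pose mu : probability (d.-tuple R) R := distribution P (xi n0).
pose nu : probability (d.-tuple R) R := distribution P zeta.
have xi_law n A : measurable A -> P (xi n @^-1` A) = mu A.
  by move=> mA; exact: etrans (xi_dens n A mA) (esym (xi_dens n0 A mA)).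
have summ (f : R -> R) : measurable_fun setT f -> (forall x, 0 <= f x) ->
    (\int[@lebesgue_vec R d]_x (f (h x))%:E < +oo)%E ->
    (\esum_(n in [set: d.-tuple int])
       \int[nu]_z \int[mu]_u (f (summand h r n (z, u)))%:E < +oo)%E.
  move=> mf f0 fy; rewrite (esum_summand (nu := nu) mu zeta_unif ih1 r0 mf f0).
  by apply: lte_mul_pinfty => //; rewrite lee_fin exprn_ge0// ltW.
have xi_mf n : measurable_fun setT (xi n) by [].
have zeta_mf : measurable_fun setT zeta by [].
have l1 n A := joint_law1 xi_law zeta_indep n (A := A).
have l2 n m A (nm : n != m) (mA : measurable A) := joint_law2 xi_law zeta_indep xi_indep nm mA.
have abs_summable : (\esum_(n in [set: d.-tuple int])
    \int[nu]_z \int[mu]_u `|summand h r n (z, u)|%:E < +oo)%E.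
  apply: (summ (fun x => `|x|)) => //.
  by have /integrableP[] := ih1.
have sq_summable : (\esum_(n in [set: d.-tuple int])
    \int[nu]_z \int[mu]_u (summand h r n (z, u) ^+ 2)%:E < +oo)%E.
  apply: (summ (fun x => x ^+ 2)) => [|x|]; [exact: measurable_funX|exact: sqr_ge0|].
  have /integrableP[_] := ih2.
  by under eq_integral do rewrite /= ger0_norm ?sqr_ge0//.
(* A single term of a nonnegative family is at most its sum. *)
have sq_fin n : (\int[nu]_z \int[mu]_u (summand h r n (z, u) ^+ 2)%:E < +oo)%E.
  apply: le_lt_trans sq_summable.
  pose a2 n := (\int[nu]_z \int[mu]_u (summand h r n (z, u) ^+ 2)%:E)%E.
  have a20 m : (0 <= a2 m)%E.
    by apply: integral_ge0 => z _; apply: integral_ge0 => u _; rewrite lee_fin sqr_ge0.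
  rewrite -[leLHS](esum_set1 (t := n) (a := a2))//.
  rewrite [leLHS]esum_mkcond; apply: le_esum => i _.
  by case: ifP => _; [exact: lexx|exact: a20].
have main := variance_ge_esum_gap (P := P) (nu := nu) (mu := mu) zeta_mf xi_mf
  (measurable_summand r ih1) l1 l2 abs_summable sq_fin.
apply: le_trans main.
apply: le_trans (esum_gap_ge ha (xi_dens n0) zeta_unif ih1 r0).
have weight := spectral_weight_ge k0 r0 (measurable_power_spectrum mh) (power_spectrum_ge0 h).
apply: le_trans weight.
under [X in (_ * (_ * X + _))%E]eq_integral do rewrite normc_fourier//.
by under [X in (_ * (_ + _ * X))%E]eq_integral do rewrite normc_fourier//.
Qed.
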